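(* Consider nearest-neighbor random walk on $\mathbb{Z}^d$ in a uniformly elliptic space--time product environment. If $d\ge3$, then there exists $\eta>0$ such that the quenched large deviation principle for the mean velocity $X_n/n$ of the particle holds in the $\eta$-neighborhood $\{\xi\in\mathbb{R}^d:|\xi-\xi_o|<\eta\}$ of $\xi_o$, with rate function identically equal to $I_a$ (the rate function of the averaged large deviation principle) in this neighborhood.
   Context: Environment. $U=\{z\in\mathbb{Z}^d: |z|=1\}$. An environment is $\omega=(\omega_{n,x})_{n\in\mathbb{Z},x\in\mathbb{Z}^d}$, where $\omega_{n,x}=(\pi_{n,n+1}(x,x+y))_{y\in\mathbb{Z}^d}$ is a probability vector. $\Omega$ is the product space of all environments, with Borel $\sigma$-algebra $\mathcal{B}$, and $\mathbb{P}$ is a product probability measure on $\Omega$ under which the $\omega_{n,x}$ are i.i.d. Standing assumptions: (nearest-neighbor) $\mathbb{P}(\pi_{0,1}(0,z)>0)=0$ unless $z\in U$; (uniform ellipticity) there is a constant $c>0$ with $\mathbb{P}(\pi_{0,1}(0,z)\ge c)=1$ for all $z\in U$. Walk. For fixed $\omega$, $P_{o,o}^\omega$ (the quenched measure) is the law of the Markov chain $(X_n)_{n\ge0}$ with $X_0=0$ and probability $\pi_{n,n+1}(y,y+z)$ of stepping from $y$ at time $n$ to $y+z$ at time $n+1$. The averaged measure is $P_{o,o}=\mathbb{P}\times P_{o,o}^\omega$. $q(z)=\mathbb{E}[\pi_{0,1}(0,z)]$ for $z\in U$; $\xi_o=\sum_{z\in U}q(z)z$ is the law-of-large-numbers velocity;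 $\phi(\theta)=\sum_{z\in U}q(z)e^{\langle\theta,z\rangle}$; $I_a(\xi)=\sup_{\theta\in\mathbb{R}^d}\{\langle\theta,\xi\rangle-\log\phi(\theta)\}$ is the rate function of the (Cramér) large deviation principle for $X_n/n$ under $P_{o,o}$. Local quenched LDP. For an open set $O\subset\mathbb{R}^d$ and a lower semicontinuous $I:O\to[0,\infty]$, the quenched LDP for the mean velocity holds in $O$ with rate function $I$ if for $\mathbb{P}$-a.e. $\omega$: $\liminf_{n\to\infty}\frac1n\log P_{o,o}^\omega(X_n/n\in G)\ge-\inf_{G}I$ for every open $G\subset O$, and $\limsup_{n\to\infty}\frac1n\log P_{o,o}^\omega(X_n/n\in F)\le-\inf_{F}I$ for every $F\subset O$ that is closed in $\mathbb{R}^d$. *)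

(* Defs.v *)
From HB Require Import structures.
From mathcomp Require Import all_boot all_order all_algebra.
From mathcomp Require Import all_classical all_reals all_analysis.
From mathcomp Require Import zify.

Set Implicit Arguments.
Unset Strict Implicit.
Unset Printing Implicit Defensive.

Import Order.TTheory GRing.Theory Num.Theory.
Import numFieldNormedType.Exports.

Local Open Scope classical_set_scope.
Local Open Scope ring_scope.

Notation site d := 'rV[int]_d.

Section euclidean.
Variables (R : realType) (d : nat).

Definition dot (x y : 'rV[R]_d) : R := \sum_(i < d) x 0 i * y 0 i.

(* Not the library norm of 'rV[R]_d, which is the sup norm. *)
Definition enorm (x : 'rV[R]_d) : R := Num.sqrt (dot x x).

Definition embed (z : site d) : 'rV[R]_d := map_mx intr z.

Definition unit_steps : set (site d) := [set z | enorm (embed z) = 1].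

End euclidean.

Arguments embed R {d} z.
Arguments unit_steps R d : clear implicits.

(* Finite-support sums over [unit_steps R d] are thus ordinary sums. *)
Lemma finite_unit_steps (R : realType) (d : nat) :
  finite_set (unit_steps R d).
Proof.
pose step (f : {ffun 'I_d -> 'I_3}) : site d := \row_i ((f i)%:Z - 1).
apply: (@sub_finite_set _ _ (step @` setT)); last first.
  exact/finite_image/finite_finset.
move=> z /= z1.
have h i : (z 0 i) ^+ 2 <= 1.
  have dz0 : 0 <= dot (embed R z) (embed R z).
    by apply: sumr_ge0 => k _; exact: sqr_ge0.
  have dz1 : dot (embed R z) (embed R z) = 1.
    by rewrite -(sqr_sqrtr dz0) -/(enorm _) z1 expr1n.
  rewrite -(ler_int R) -[leRHS]dz1 /dot (bigD1 i)//= !mxE expr2 intrM lerDl.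
  by apply: sumr_ge0 => k _; exact: sqr_ge0.
have h' i : -1 <= z 0 i <= 1 by have := h i; nia.
exists [ffun i => inord (absz (z 0 i + 1)%R)] => //.
apply/rowP => i; rewrite mxE ffunE inordK.
  by have := h' i; lia.
by have := h' i; lia.
Qed.

(* <<s coord_gen f >> is the product sigma-algebra when f lists coordinates. *)
Definition coord_gen (I aT : Type) (disp : measure_display)
    (rT : measurableType disp) (f : I -> aT -> rT) : set (set aT) :=
  \bigcup_i preimage_set_system setT (f i) measurable.

Section prob_vector.
Variables (R : realType) (d : nat).

Record prob_vector := ProbVector {
  prob_vector_fun :> site d -> R ;
  prob_vector_ge0 : forall y, 0 <= prob_vector_fun y ;
  prob_vector_sum1 : \esum_(y in setT) (prob_vector_fun y)%:E = 1%E }.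

Let p0 (y : site d) : R := (y == 0)%:R.

Let p0_ge0 y : 0 <= p0 y. Proof. exact: ler0n. Qed.

Let p0_sum1 : \esum_(y in setT) (p0 y)%:E = 1%E.
Proof.
rewrite (esumID [set 0]) => [|y _]; last by rewrite lee_fin.
rewrite setTI esum_set1 ?lee_fin//= {1}/p0 eqxx/=.
rewrite esum1 ?adde0// => y [_ /= /eqP y0].
by rewrite /p0 (negbTE y0).
Qed.

HB.instance Definition _ := gen_eqMixin prob_vector.
HB.instance Definition _ := gen_choiceMixin prob_vector.
HB.instance Definition _ :=
  isPointed.Build prob_vector (ProbVector p0_ge0 p0_sum1).

Definition prob_vector_gen : set (set prob_vector) :=
  coord_gen (fun (y : site d) (p : prob_vector) => p y : measurableTypeR R).

HB.instance Definition _ :=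
  Measurable.copy prob_vector (g_sigma_algebraType prob_vector_gen).

End prob_vector.

Section environment.
Variables (R : realType) (d : nat).

(* [w n x z] is pi_{n,n+1}(x, x + z). *)
Definition env := int -> site d -> prob_vector R d.

HB.instance Definition _ := Pointed.on env.

Definition env_gen : set (set env) :=
  coord_gen (fun (i : int * site d) (w : env) => w i.1 i.2).

HB.instance Definition _ :=
  Measurable.copy env (g_sigma_algebraType env_gen).

End environment.

Section walk.
Variable d : nat.

Definition walk := nat -> site d.

HB.instance Definition _ := gen_eqMixin walk.
HB.instance Definition _ := gen_choiceMixin walk.
HB.instance Definition _ := isPointed.Build walk (fun=> 0).

Definition walk_gen : set (set walk) :=
  [set A | exists n x, A = [set X : walk | X n = x]].

HB.instance Definition _ :=
  Measurable.copy walk (g_sigma_algebraType walk_gen).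

End walk.

Section model.
Variables (R : realType) (d : nat) (P : probability (env R d) R).

Local Open Scope ereal_scope.

Definition iid_env : Prop :=
  (forall (s : seq (int * site d))
          (A : int * site d -> set (prob_vector R d)),
     uniq s -> (forall i, measurable (A i)) ->
     P [set w : env R d | forall i, i \in s -> A i (w i.1 i.2)] =
       \prod_(i <- s) P [set w : env R d | A i (w i.1 i.2)]) /\
  (forall (i j : int * site d) (A : set (prob_vector R d)), measurable A ->
     P [set w : env R d | A (w i.1 i.2)] =
       P [set w : env R d | A (w j.1 j.2)]).

Definition nearest_neighbor : Prop :=
  forall z : site d, ~ unit_steps R d z ->
    P [set w : env R d | (0 < w 0%R 0%R z)%R] = 0.

Definition uniformly_elliptic : Prop :=
  exists2 c : R, (0 < c)%R &
    forall z : site d, unit_steps R d z ->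
      P [set w : env R d | (c <= w 0%R 0%R z)%R] = 1.

Definition mean_step (z : site d) : R :=
  fine 'E_P[fun w : env R d => w 0%R 0%R z].

Definition lln_velocity : 'rV[R]_d :=
  (\sum_(z \in unit_steps R d) mean_step z *: embed R z)%R.

Definition mgf (theta : 'rV[R]_d) : R :=
  (\sum_(z \in unit_steps R d) mean_step z * expR (dot theta (embed R z)))%R.

Definition averaged_rate (xi : 'rV[R]_d) : \bar R :=
  ereal_sup
    [set (dot theta xi - ln (mgf theta))%:E | theta in [set: 'rV[R]_d]].

(* [Q] is the law of the Markov chain started at 0 at time 0 in the
   environment [w]; it is determined by the probabilities of finite paths. *)
Definition quenched_law (w : env R d) (Q : probability (walk d) R) : Prop :=
  Q [set X | X 0%N = 0%R] = 1 /\
  forall (n : nat) (x : walk d),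
    Q [set X | forall k, (k <= n.+1)%N -> X k = x k] =
    Q [set X | forall k, (k <= n)%N -> X k = x k] *
      (w n%:Z (x n) (x n.+1 - x n)%R)%:E.

Definition velocity (n : nat) (X : walk d) : 'rV[R]_d :=
  (n%:R^-1 *: embed R (X n))%R.

(* [subspace O] makes the third clause lower semicontinuity of I restricted
   to O.  In [log_prob], lne 0 = -oo. *)
Definition quenched_LDP (Pq : env R d -> probability (walk d) R)
    (O : set 'rV[R]_d) (I : 'rV[R]_d -> \bar R) : Prop :=
  let log_prob w (A : set 'rV[R]_d) (n : nat) :=
    (n%:R^-1)%:E * lne (Pq w [set X | A (velocity n X)]) in
  [/\ open O,
      forall xi, O xi -> 0 <= I xi,
      lower_semicontinuous (I : subspace O -> \bar R) &
      {ae P, forall w,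
        (forall G : set 'rV[R]_d, open G -> G `<=` O ->
           - ereal_inf (I @` G) <= limn_einf (log_prob w G)) /\
        (forall F : set 'rV[R]_d, closed F -> F `<=` O ->
           limn_esup (log_prob w F) <= - ereal_inf (I @` F))}].

End model.

(* Main.v *)
(* Multiply the step kernel by [e^{<th, z>} / mgf th] and sum the products of the
   tilted kernel over [n]-step paths: this partition function [F_n] has mean 1,
   and both bounds of the quenched LDP follow by exponential tilting
   once [F_n] neither grows nor decays exponentially, almost surely and for all
   small [th].

   Growth is excluded by Markov's inequality. Decay is excluded by a second
   moment argument: [E (F_n(x) F_n(y)) <= 1 + f (x - y)], where
   [f x = (1 + |x|_*^2 / M)^{-1/4}] is a Lyapunov function of the difference of
   two independent walks, which exists because that difference is transient for
   [d >= 3]; at [x = y] the correlation is absorbed, for small [th], by the gap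
   between [f 0] and the values of [f] off the origin. If the two walks first
   take [k] steps under the averaged kernel, the bound drops to
   [1 + O(k^{-1/5})], so the partition function is at least 1/2 with probability
   close to 1, and by uniform ellipticity this start costs only [c^k], with
   [k = o(n)]. Borel-Cantelli along polynomially growing times concludes.

   For [xi] near [lln_velocity], the supremum in [averaged_rate] is attained at
   a small [th], so tilting by small [th] suffices. *)

From HB Require Import structures.
Require Import Defs.
From mathcomp Require Import all_boot all_order all_algebra.
From mathcomp Require Import all_classical all_reals all_analysis.
From mathcomp Require Import measurable_realfun ring lra zify.

Set Implicit Arguments.
Unset Strict Implicit.
Unset Printing Implicit Defensive.

Import Order.TTheory GRing.Theory Num.Theory.
Import numFieldNormedType.Exports.

Local Open Scope classical_set_scope.
Local Open Scope ring_scope.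

(** A second moment of at most 2 only keeps [F_n] away from 0 with positive probability, whereas an
    almost sure bound needs failure probabilities that are summable along a subsequence. The
    averaged start supplies them. Iterating [L f <= f - gamma * f ^+ 5] makes [(L^k f)(0)] of order
    [k^{-1/5}], so the times [k = (j + 2)^10] fail with probability of order [j^{-2}]; their
    successive ratios still tend to 1, so the gaps are crossed with a crude lower bound on the
    weights of the steps.

    The exceptional null set depends on the tilt, while the LDP uses uncountably many tilts in one
    environment. Rational tilts suffice, since moving [th] by [dl] in sup norm changes [F_n] by a
    factor of at most [e^{2 dl n}].

    In the lower bound, the mass that the tilt by [th] leaves away from [xi] is dominated by [2d]
    further tilts [th + t * v], with [v] a unit step. Each is exponentially smaller, because [th] is
    a critical point: moving away from it costs only second order in [t], while the distance from
    [xi] gains first order. *)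

(* [r = (1 + v)^{-1/4}]; the second Taylor coefficient is [10 / 64]. *)
Lemma quarter_root_le (R : realType) (r v : R) :
  0 < r -> r ^+ 4 * (1 + v) = 1 -> `|v| <= 100^-1 ->
  r <= 1 - v / 4 + 11 / 64 * v ^+ 2.
Proof.
move=> r0 rv; rewrite ler_norml => /andP[v1 v2].
rewrite leNgt; apply/negP => ltr.
(* If [r] exceeded the right side [1 + v * g], then [(1 + v * g)^4 (1 + v) < 1]. Expanded, this
   product is 1 plus [v ^+ 2] times a bracket which at [v = 0] equals [-1 + 11/16 + 6/16 = 1/16];
   with [10/64] the bracket would vanish there. *)
set g : R := - 4^-1 + 11 / 64 * v.
have gE : 1 - v / 4 + 11 / 64 * v ^+ 2 = 1 + v * g by rewrite /g; field.
rewrite gE in ltr.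
have g1 : - (253 / 1000) <= g by rewrite /g; lra.
have g2 : g <= - (247 / 1000) by rewrite /g; lra.
have vg : 0 < 1 + v * g by nra.
have v1_gt0 : 0 < 1 + v by lra.
have : (1 + v * g) ^+ 4 * (1 + v) < 1.
  by rewrite -[ltRHS]rv ltr_pM2r// ltrXn2r// ltW.
rewrite ltNge => /negP; apply.
have -> : (1 + v * g) ^+ 4 * (1 + v) = 1 + v ^+ 2 *
    (- 1 + (1 + v) * (11 / 16 + 6 * g ^+ 2 + 4 * v * g ^+ 3 + v ^+ 2 * g ^+ 4)).
  by rewrite /g; field.
rewrite lerDl mulr_ge0// ?sqr_ge0//.
have gg1 : 61 / 1000 <= g ^+ 2 by nra.
have gg2 : g ^+ 2 <= 65 / 1000 by nra.
have g4 : 0 <= v ^+ 2 * g ^+ 4 by rewrite mulr_ge0// exprn_even_ge0.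
have gv : - (1 / 100) <= v * g * 2 by nra.
have g3 : - (1 / 100) <= 4 * v * g ^+ 3.
  have -> : 4 * v * g ^+ 3 = 2 * (v * g * 2) * g ^+ 2 by ring.
  nra.
have : 104 / 100 <= 11 / 16 + 6 * g ^+ 2 + 4 * v * g ^+ 3 + v ^+ 2 * g ^+ 4 by lra.
set X := _ + v ^+ 2 * g ^+ 4; move=> hX.
nra.
Qed.

(** * Lyapunov function for a symmetric walk in dimension at least 3 *)

Section lyapunov.
Variables (R : realType) (d : nat) (I : finType).
Variables (w : I -> 'rV[R]_d) (p0 : I -> R) (sigma : I -> I).
Hypothesis d3 : (3 <= d)%N.
Hypothesis p0_gt0 : forall i, 0 < p0 i.
Hypothesis sigmaK : involutive sigma.
Hypothesis w_sigma : forall i, w (sigma i) = - w i.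
Hypothesis w_span : forall v : 'rV[R]_d, (forall i, v *m (w i)^T = 0) -> v = 0.

(** Covariance of the steps under [p0]. Lengths are measured by its inverse, which makes the walk
    isotropic: a step has mean square product [Q x] with [x] ([QE]) and mean square length [d]
    ([trQ]). *)
Let C : 'M[R]_d := \sum_i p0 i *: ((w i)^T *m w i).
Let A := invmx C.
Let b (x y : 'rV[R]_d) : R := (x *m A *m y^T) 0 0.
Let Q (x : 'rV[R]_d) : R := b x x.

Let covE (u v : 'rV[R]_d) :
  (u *m C *m v^T) 0 0 = \sum_i p0 i * ((u *m (w i)^T) 0 0 * (v *m (w i)^T) 0 0).
Proof.
rewrite /C mulmx_sumr mulmx_suml summxE; apply: eq_bigr => i _.
rewrite -scalemxAr -scalemxAl mxE; congr (_ * _)%R.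
rewrite (_ : _ *m v^T = (u *m (w i)^T) *m (w i *m v^T)); last by rewrite !mulmxA.
rewrite mxE big_ord1; congr (_ * _).
by rewrite -[LHS]trace_mx11 -mxtrace_tr trmx_mul trmxK trace_mx11.
Qed.

Let C_unit : C \in unitmx.
Proof.
rewrite -row_free_unit -kermx_eq0; apply/eqP/row_matrixP => i; rewrite row0.
set v := row i _.
have vC : v *m C = 0 by rewrite /v -row_mul mulmx_ker row0.
apply: w_span => j.
have /eqP : (v *m C *m v^T) 0 0 = 0 by rewrite vC mul0mx mxE.
rewrite covE psumr_eq0 => [/allP/(_ j)|k _]; last first.
  by rewrite -expr2 mulr_ge0 ?sqr_ge0// ltW.
rewrite mem_index_enum implyTb => /(_ isT).
rewrite mulf_eq0 gt_eqF//= -expr2 sqrf_eq0 => /eqP vw.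
by apply/matrixP => k l; rewrite !ord1 vw mxE.
Qed.

Let C_sym : C^T = C.
Proof.
rewrite /C raddf_sum/=; apply: eq_bigr => i _.
by rewrite linearZ/= trmx_mul trmxK.
Qed.

Let A_sym : A^T = A. Proof. by rewrite /A trmx_inv C_sym. Qed.

Let bC x y : b x y = b y x.
Proof. by rewrite /b -mulmxA -[LHS]trace_mx11 -mxtrace_tr !trmx_mul trmxK A_sym trace_mx11. Qed.

Let QE x : \sum_i p0 i * b x (w i) ^+ 2 = Q x.
Proof.
transitivity (\sum_i p0 i * ((x *m A *m (w i)^T) 0 0 * (x *m A *m (w i)^T) 0 0)).
  by apply: eq_bigr => i _; rewrite expr2.
rewrite -covE /Q /b /A mulmxKV// trmx_mul -/A A_sym mulmxA.
by [].
Qed.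

Let Q_ge0 x : 0 <= Q x.
Proof. by rewrite -QE sumr_ge0// => i _; rewrite mulr_ge0 ?sqr_ge0// ltW. Qed.

Let Q_eq0 x : Q x = 0 -> x = 0.
Proof.
move=> /eqP; rewrite -QE psumr_eq0 => [/allP h|i _]; last first.
  by rewrite mulr_ge0 ?sqr_ge0// ltW.
have : x *m A = 0.
  apply: w_span => j; move: (h j); rewrite mem_index_enum implyTb => /(_ isT).
  rewrite mulf_eq0 gt_eqF//= sqrf_eq0 => /eqP xw.
  by apply/matrixP => k l; rewrite !ord1 [RHS]mxE; exact: xw.
by move=> xA; rewrite -[x](mulmxKV C_unit) -/A xA mul0mx.
Qed.

Let bDl x y z : b (x + y) z = b x z + b y z.
Proof. by rewrite /b !mulmxDl [LHS]mxE. Qed.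

Let QD x y : Q (x + y) = Q x + 2 * b x y + Q y.
Proof.
rewrite /Q bDl bC [b y _]bC !bDl (bC y x); ring.
Qed.

Let trQ : \sum_i p0 i * Q (w i) = d%:R.
Proof.
rewrite -(mxtrace1 R d) -(mulVmx C_unit) {2}/C mulmx_sumr raddf_sum/=.
apply: eq_bigr => i _; rewrite -scalemxAr mxtraceZ; congr (_ * _).
by rewrite /Q /b -trace_mx11 mxtrace_mulC [RHS]mxtrace_mulC mulmxA.
Qed.

Let K := \sum_i p0 i * Q (w i) ^+ 2.
(** A length scale so large that one step changes [M + Q x] by a relative amount of at most [1/100],
    and that the fourth moment [K] is negligible against it. *)
Let M := 1 + \sum_i (400 * (400 / p0 i) + 200 * Q (w i)) + 100 * K.

Let K_ge0 : 0 <= K.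
Proof. by apply: sumr_ge0 => i _; rewrite mulr_ge0 ?sqr_ge0// ltW. Qed.

Let term_ge0 i : 0 <= 400 * (400 / p0 i) + 200 * Q (w i).
Proof. have p_ge0 := ltW (p0_gt0 i); have Qw_ge0 := Q_ge0 (w i).
exact: (addr_ge0 (mulr_ge0 (ler0n _ _) (divr_ge0 (ler0n _ _) p_ge0)) (mulr_ge0 (ler0n _ _) Qw_ge0)). Qed.

Let M_ge1 : 1 <= M.
Proof.
rewrite /M -addrA lerDl addr_ge0//; first by apply: sumr_ge0.
by rewrite mulr_ge0.
Qed.

Let M_term i : 400 * (400 / p0 i) <= M /\ 200 * Q (w i) <= M.
Proof.
have : 400 * (400 / p0 i) + 200 * Q (w i) <= M.
  rewrite /M (bigD1 i)//=.
  set S := \sum_(_ | _) _; have S0 : 0 <= S by apply: sumr_ge0.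
  have := K_ge0; lra.
have := Q_ge0 (w i); have : 0 <= 400 * (400 / p0 i) by apply: mulr_ge0; rewrite ?divr_ge0 ?ler0n// ltW.
by move=> *; split; lra.
Qed.

Let M_K : 100 * K <= M.
Proof.
rewrite /M; set S := \sum_(_ | _) _; have S0 : 0 <= S by apply: sumr_ge0.
lra.
Qed.

(** Of order [|x|^{-1/2}] at infinity. This decays more slowly than the Green function [|x|^{2-d}],
    which is why [f] is strictly superharmonic. *)
Let f x := (Num.sqrt (Num.sqrt (1 + Q x / M)))^-1.

Let M_gt0 : 0 < M. Proof. by rewrite (lt_le_trans _ M_ge1). Qed.

Let arg_gt0 x : 0 < 1 + Q x / M.
Proof. by rewrite ltr_pwDl// divr_ge0// ltW. Qed.

Let f_gt0 x : 0 < f x.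
Proof. by rewrite invr_gt0 !sqrtr_gt0. Qed.

Let fX4 x : f x ^+ 4 * (1 + Q x / M) = 1.
Proof.
rewrite /f exprVn (_ : 4 = 2 * 2)%N// exprM sqr_sqrtr ?sqrtr_ge0//.
by rewrite sqr_sqrtr ?mulVf// ?gt_eqF// ltW.
Qed.

(** Here [v] is the relative increment of [M + Q] under the step [w i], so [f (x + w i) / f x] is
    exactly [(1 + v)^{-1/4}]. *)
Let ratio_le x i S v : S = M + Q x -> v = (2 * b x (w i) + Q (w i)) / S ->
  f (x + w i) <= f x * (1 - v / 4 + 11 / 64 * v ^+ 2).
Proof.
move=> SE vE; rewrite -ler_pdivrMl// mulrC.
have S_gt0 : 0 < S by rewrite SE ltr_pwDl.
apply: quarter_root_le; first by rewrite divr_gt0.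
  have e : 1 + Q (x + w i) / M = (1 + Q x / M) * (1 + v).
    rewrite QD vE SE; field; rewrite -SE !gt_eqF//.
  have := fX4 (x + w i); rewrite e mulrA => e1.
  have q0 : 1 + Q x / M != 0 by rewrite gt_eqF.
  have h : f (x + w i) ^+ 4 * (1 + v) = f x ^+ 4.
    by apply: (mulIf q0); rewrite fX4 -[RHS]e1; ring.
  by rewrite expr_div_n mulrAC h divff// expf_neq0// gt_eqF.
rewrite vE normrM normfV (gtr0_norm S_gt0) ler_pdivrMr//.
have [M1 M2] := M_term i.
have MS : M <= S by rewrite SE lerDl.
have Qw : 0 <= Q (w i) := Q_ge0 _.
rewrite (le_trans (ler_normD _ _))// (ger0_norm Qw).
suff : `|2 * b x (w i)| <= S / 200 by lra.
have S200 : 0 <= S / 200 by lra.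
rewrite -(@ler_pXn2r _ 2) ?nnegrE//.
rewrite real_normK ?num_real// exprMn.
(* A single term of [QE] plays the role of the Cauchy-Schwarz inequality, at the price of the factor
   [1 / p0 i] that [M] absorbs. *)
have h1 : p0 i * b x (w i) ^+ 2 <= Q x.
  rewrite -QE (bigD1 i)//= lerDl sumr_ge0// => j _.
  by rewrite mulr_ge0 ?sqr_ge0// ltW.
have h2 : b x (w i) ^+ 2 <= S / p0 i.
  by rewrite ler_pdivlMr// mulrC (le_trans h1)// SE lerDr ltW.
have h3 : 400 * (400 / p0 i) <= S by exact: le_trans MS.
have h4 : S / p0 i <= (S / 400) * (S / 400).
  have -> : S / 400 * (S / 400) = S * (S / 400 / 400) by field.
  rewrite ler_pM2l//; lra.
lra.
Qed.

(* [f^4 = M / (M + Q)] with [Q] the inverse covariance form of [p0]: under [p]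
   the drift of [f] is at most [f * (11 / 4 - d) / (4 * (M + Q))] up to small
   relative errors, which is negative for [d >= 3], and [1 / (M + Q)] is of
   order [f^4]. *)
Lemma lyapunov : exists (f : 'rV[R]_d -> R) (gamma : R),
  [/\ 0 < gamma, forall x, 0 < f x <= 1, f 0 = 1, forall x, x != 0 -> f x < 1 &
  forall p : I -> R, \sum_i p i = 1 -> (forall i, p (sigma i) = p i) ->
    (forall i, 99 / 100 * p0 i <= p i <= 101 / 100 * p0 i) ->
  forall x, \sum_i p i * f (x + w i) <= f x - gamma * f x ^+ 5].
Proof.
(* As [f ^+ 4 = M / S] with [S = M + Q x], this [gamma] turns the required decrease [gamma * f ^+ 5]
   into [f / (50 * S)]. *)
exists f, (50 * M)^-1; split.
- by rewrite invr_gt0 mulr_gt0.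
- move=> x; rewrite f_gt0/= /f invf_le1 ?sqrtr_gt0 ?sqrtr_gt0//.
  rewrite -[leLHS]sqrtr1 ler_sqrt ?sqrtr_ge0// -[leLHS]sqrtr1 ler_sqrt ?(ltW (arg_gt0 x))//.
  by rewrite lerDl divr_ge0// ltW.
- rewrite /f (_ : Q 0 = 0); last first.
    by rewrite /Q /b mul0mx mul0mx mxE.
  by rewrite mul0r addr0 !sqrtr1 invr1.
- move=> x x0; rewrite /f invf_lt1 ?sqrtr_gt0 ?sqrtr_gt0//.
  rewrite -[ltLHS]sqrtr1 ltr_sqrt ?sqrtr_gt0// -[ltLHS]sqrtr1 ltr_sqrt//.
  rewrite ltrDl divr_gt0// lt_neqAle Q_ge0 andbT eq_sym.
  by apply: contraNneq x0 => /Q_eq0 ->.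
move=> p p1 ps pb x.
set S := M + Q x.
have S_gt0 : 0 < S by rewrite ltr_pwDl.
pose v i := (2 * b x (w i) + Q (w i)) / S.
apply: (@le_trans _ _ (f x * \sum_i p i * (1 - v i / 4 + 11 / 64 * v i ^+ 2))).
  rewrite mulr_sumr; apply: ler_sum => i _; rewrite mulrCA ler_wpM2l//.
    by have /andP[+ _] := pb i; apply: le_trans; rewrite mulr_ge0// ltW.
  exact: (ratio_le _ erefl).
(* Symmetry under [sigma] removes every term that is odd in the step, among them the first-order
   one. *)
have odd0 (g : I -> R) : (forall i, g (sigma i) = - g i) -> \sum_i p i * g i = 0.
  move=> go; set t := LHS; suff : t = - t by lra.
  rewrite /t {1}(reindex_inj (inv_inj sigmaK))/= -sumrN.
  by apply: eq_bigr => i _; rewrite ps go mulrN.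
have bs i : b x (w (sigma i)) = - b x (w i).
  by rewrite w_sigma /b linearN/= mulmxN mxE.
have Qs i : Q (w (sigma i)) = Q (w i).
  by rewrite w_sigma /Q /b linearN/= mulmxN mulNmx mulNmx opprK.
have s1 : \sum_i p i * b x (w i) = 0 by apply: odd0.
have s2 : \sum_i p i * (b x (w i) * Q (w i)) = 0.
  by apply: odd0 => i; rewrite bs Qs mulNr.
set T1 := \sum_i p i * Q (w i).
set T2 := \sum_i p i * b x (w i) ^+ 2.
set T3 := \sum_i p i * Q (w i) ^+ 2.
have -> : \sum_i p i * (1 - v i / 4 + 11 / 64 * v i ^+ 2) =
    1 - T1 / (4 * S) + 11 / 64 * (4 * T2 + T3) / S ^+ 2.
  transitivity (\sum_i p i - (2 * \sum_i p i * b x (w i) + T1) / (4 * S) +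
      11 / 64 * (4 * T2 + 4 * (\sum_i p i * (b x (w i) * Q (w i))) + T3) / S ^+ 2).
    rewrite /T1 /T2 /T3 !mulr_sumr -!big_split/= !mulr_suml.
    rewrite mulr_sumr mulr_suml -sumrB -big_split/=.
    apply: eq_bigr => i _; rewrite /v; field; rewrite gt_eqF//.
  by rewrite p1 s1 s2 !mulr0 !addr0 add0r.
have T1b : 99 / 100 * 3 <= T1.
  apply: (@le_trans _ _ (99 / 100 * d%:R)).
    by rewrite ler_pM2l// (ler_nat _ 3).
  rewrite -trQ mulr_sumr; apply: ler_sum => i _; rewrite mulrA ler_wpM2r//.
  by have /andP[] := pb i.
have T2b : T2 <= 101 / 100 * S.
  apply: (@le_trans _ _ (101 / 100 * Q x)); last by rewrite ler_pM2l// lerDr ltW.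
  rewrite /T2 -[Q x]QE mulr_sumr; apply: ler_sum => i _; rewrite [leRHS]mulrA ler_wpM2r ?sqr_ge0//.
  by have /andP[] := pb i.
have T3b : T3 <= 101 / 100 * K.
  rewrite /T3 /K mulr_sumr; apply: ler_sum => i _; rewrite [leRHS]mulrA ler_wpM2r ?sqr_ge0//.
  by have /andP[] := pb i.
have f4 : f x ^+ 4 = M / S.
  apply: (mulIf (_ : 1 + Q x / M != 0)); first by rewrite gt_eqF.
  by rewrite fX4 /S; field; rewrite !gt_eqF.
rewrite [f x ^+ 5]exprS f4.
have -> : (50 * M)^-1 * (f x * (M / S)) = f x * (1 / 50 / S).
  by field; rewrite !gt_eqF.
have fxE : f x - f x * (1 / 50 / S) = f x * (1 - 1 / 50 / S) by ring.
rewrite fxE ler_pM2l//.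
have KS : K <= S / 100 by have := M_K; have := Q_ge0 x; rewrite /S; lra.
have -> : 1 - T1 / (4 * S) + 11 / 64 * (4 * T2 + T3) / S ^+ 2 =
   1 + (- T1 / 4 + (11 / 64 * (4 * T2 + T3)) / S) / S.
  by field; rewrite gt_eqF.
have -> : 1 - 1 / 50 / S = 1 + (- (1 / 50)) / S by field; rewrite gt_eqF.
rewrite lerD2l ler_pM2r ?invr_gt0//.
(* The competition for [d = 3] is [3/4] against [11/16]. With the errors of one percent, [T1 / 4] is
   at least [0.7425], and [0.71] still leaves more than the required [1/50]. *)
suff : (11 / 64 * (4 * T2 + T3)) / S <= 71 / 100 by lra.
rewrite ler_pdivrMr//; lra.
Qed.

End lyapunov.

(** * Independence of functions of disjoint sets of sites *)

Section expectation_indep.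
Context d d1 d2 (T : measurableType d) (T1 : measurableType d1)
  (T2 : measurableType d2) (R : realType) (P : probability T R).
Local Open Scope ereal_scope.

(** The joint law of [X] and [Y] agrees with the product of their laws on rectangles, hence
    everywhere; Tonelli does the rest. *)
Lemma expectation_mul_indep (X : T -> T1) (Y : T -> T2) (f : T1 -> R) (g : T2 -> R) :
  measurable_fun setT X -> measurable_fun setT Y ->
  (forall A B, measurable A -> measurable B ->
     P (X @^-1` A `&` Y @^-1` B) = P (X @^-1` A) * P (Y @^-1` B)) ->
  measurable_fun setT f -> measurable_fun setT g ->
  (forall x, 0 <= f x)%R -> (forall y, 0 <= g y)%R ->
  \int[P]_w (f (X w) * g (Y w))%:E =
  \int[P]_w (f (X w))%:E * \int[P]_w (g (Y w))%:E.
Proof.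
move=> mX mY XY mf mg f0 g0.
pose X' : {mfun T >-> T1} := HB.pack X (isMeasurableFun.Build _ _ _ _ _ mX).
pose Y' : {mfun T >-> T2} := HB.pack Y (isMeasurableFun.Build _ _ _ _ _ mY).
have mXY : measurable_fun setT (fun w => (X w, Y w)) by exact: measurable_fun_pair.
pose XY' : {mfun T >-> (T1 * T2)%type} :=
  HB.pack (fun w => (X w, Y w)) (isMeasurableFun.Build _ _ _ _ _ mXY).
pose m1 := distribution P X'; pose m2 := distribution P Y'.
have mfe : measurable_fun setT (fun x => (f x)%:E) by exact/measurable_EFinP.
have mge : measurable_fun setT (fun x => (g x)%:E) by exact/measurable_EFinP.
pose h (z : T1 * T2) := (f z.1 * g z.2)%:E.
have mh : measurable_fun setT h.
  apply/measurable_EFinP; apply: measurable_funM.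
    exact: (measurableT_comp mf measurable_fst).
  exact: (measurableT_comp mg measurable_snd).
have h0 z : 0 <= h z by rewrite lee_fin mulr_ge0.
transitivity (\int[distribution P XY']_z h z).
  by rewrite ge0_integral_distribution.
transitivity (\int[m1 \x m2]_z h z).
  apply: eq_measure_integral => A mA _; apply/esym.
  by apply: product_measure_unique.
rewrite fubini_tonelli1//.
transitivity (\int[m1]_x ((\int[m2]_y (g y)%:E) * (f x)%:E)).
  apply: eq_integral => x _; rewrite /fubini_F /h/=.
  under eq_integral do rewrite EFinM.
  rewrite ge0_integralZl_EFin//; last by move=> y _; rewrite lee_fin.
  by rewrite muleC.
rewrite ge0_integralZl//; last 2 first.
  by move=> x _; rewrite lee_fin.
  by apply: integral_ge0 => y _; rewrite lee_fin.
rewrite muleC; congr (_ * _).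
  by rewrite ge0_integral_distribution// => x; rewrite lee_fin.
by rewrite ge0_integral_distribution// => x; rewrite lee_fin.
Qed.

End expectation_indep.

Section restriction.
Variables (R : realType) (d : nat).
Implicit Types (J : set (int * site d)) (s : seq (int * site d)).
Implicit Types A : int * site d -> set (prob_vector R d).

Definition cyl s A : set (env R d) := [set w | forall i, i \in s -> A i (w i.1 i.2)].

Definition cylinders : set (set (env R d)) :=
  [set C | exists s A, (forall i, measurable (A i)) /\ C = cyl s A].

Lemma measurable_coord (i : int * site d) :
  measurable_fun setT (fun w : env R d => w i.1 i.2).
Proof.
move=> _ A mA; rewrite setTI; apply: sub_sigma_algebra.
by exists i => //; exists A => //; rewrite setTI.
Qed.

Lemma measurable_cyl s A : (forall i, measurable (A i)) -> measurable (cyl s A).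
Proof.
move=> mA; elim: s => [|i s ih].
  rewrite (_ : cyl _ _ = setT); first exact: measurableT.
  by apply/seteqP; split.
rewrite (_ : cyl _ _ = (fun w : env R d => w i.1 i.2) @^-1` (A i) `&` cyl s A).
  apply: measurableI => //; rewrite -[X in measurable X]setTI.
  exact: measurable_coord.
apply/seteqP; split => [w h|w [h1 h2] j].
  by split=> [|j js]; apply: h; rewrite inE ?eqxx// js orbT.
by rewrite inE => /predU1P[->//|]; exact: h2.
Qed.

(** Brings two cylinders over one common list of sites, the form in which [iid_env] can be
    applied. *)
Lemma cyl_widen s s' A : {subset s <= s'} ->
  cyl s A = cyl s' (fun i => if i \in s then A i else setT).
Proof.
move=> ss'; apply/seteqP; split => [w h i is'|w h i is_].
  by case: ifPn => // is_; exact: h.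
by have := h _ (ss' _ is_); rewrite is_.
Qed.

Lemma cylI s A B : cyl s A `&` cyl s B = cyl s (fun i => A i `&` B i).
Proof.
apply/seteqP; split => [w [h1 h2] i is_|w h].
  by split; [exact: h1|exact: h2].
by split=> i /h[].
Qed.

Lemma measurable_if_setT s A : (forall i, measurable (A i)) ->
  forall i, measurable (if i \in s then A i else setT).
Proof. by move=> mA i; case: ifP. Qed.

Lemma cylinders_setI : setI_closed cylinders.
Proof.
move=> _ _ [s [A [mA ->]]] [s' [A' [mA' ->]]].
rewrite (@cyl_widen s (s ++ s')) => [|i]; last by rewrite mem_cat => ->.
rewrite (@cyl_widen s' (s ++ s')) => [|i]; last by rewrite mem_cat orbC => ->.
rewrite cylI; eexists; eexists; split; last reflexivity.
by move=> i; apply: measurableI; apply: measurable_if_setT.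
Qed.

Lemma cylinders_measurable : cylinders `<=` measurable.
Proof. by move=> _ [s [A [mA ->]]]; exact: measurable_cyl. Qed.

Lemma cylinders_gen (A : set (env R d)) : measurable A -> <<s cylinders >> A.
Proof.
apply: smallest_sub; first exact: smallest_sigma_algebra.
move=> _ [i _ [B mB <-]]; apply: sub_sigma_algebra.
exists [:: i], (fun=> B); split=> //; rewrite setTI.
apply/seteqP; split => [w h j|w]; first by rewrite inE => /eqP ->.
by apply; rewrite inE.
Qed.

Lemma eq_on_cylinders (m1 m2 : {measure set (env R d) -> \bar R}) :
  (m1 setT < +oo)%E -> (forall C, cylinders C -> m1 C = m2 C) ->
  forall D : set (env R d), measurable D -> m1 D = m2 D.
Proof.
move=> m1oo m12 D mD.
have cT : cylinders setT.
  exists [::], (fun=> setT); split; first by move=> _; exact: measurableT.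
  by apply/seteqP; split.
apply: (@g_sigma_algebra_measure_unique _ _ _ cylinders cylinders_measurable (fun=> setT)) => //.
- by rewrite bigcup_const.
- exact: cylinders_setI.
- exact: cylinders_gen.
Qed.

(* Coordinates outside [J] are reset to a constant; [dep J f] below then says
   that [f] is a function of the coordinates in [J] only. *)
Definition restr J (w : env R d) : env R d :=
  fun n x => if pselect (J (n, x)) then w n x else point.

Lemma restr_coord J w (i : int * site d) : J i -> restr J w i.1 i.2 = w i.1 i.2.
Proof. by case: i => n x Jnx; rewrite /restr; case: pselect. Qed.

(** Off [J] the reset coordinate is the constant [point], so its event becomes sure or impossible.
    Preimages of cylinders under [restr J] are therefore cylinders again. *)
Definition restr_ev J A : int * site d -> set (prob_vector R d) :=
  fun i => if pselect (J i) then A i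
           else (if pselect (A i point) then setT else set0).

Lemma restr_preimage J s A : restr J @^-1` (cyl s A) = cyl s (restr_ev J A).
Proof.
rewrite /restr_ev; apply/seteqP; split => w h [n x] is_; have := h _ is_;
  rewrite /restr/=; case: pselect => //= _; case: pselect => //.
Qed.

Lemma measurable_restr_ev J A : (forall i, measurable (A i)) ->
  forall i, measurable (restr_ev J A i).
Proof.
move=> mA i; rewrite /restr_ev; case: (pselect (J i)) => [Ji|_] /=; first exact: mA.
by case: (pselect (A i point)) => _ /=; [exact: measurableT|exact: measurable0].
Qed.

Lemma measurable_restr J : measurable_fun setT (restr J).
Proof.
apply: (@measurability _ _ (env R d) (env R d) setT (restr J) (@env_gen R d)) => //.
move=> _ [_ [i _ [B mB <-]] <-]; rewrite !setTI.
case: (pselect (J i)) => Ji.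
  have -> : restr J @^-1` ((fun w : env R d => w i.1 i.2) @^-1` B) =
      (fun w : env R d => w i.1 i.2) @^-1` B.
    by apply/seteqP; split => w; rewrite /preimage/= restr_coord.
  by rewrite -[X in measurable X]setTI; exact: measurable_coord.
have -> : restr J @^-1` ((fun w : env R d => w i.1 i.2) @^-1` B) = [set _ | B point].
  case: i Ji => n x Ji.
  by apply/seteqP; split => w /=; rewrite /restr; case: pselect.
case: (pselect (B point)) => Bp.
  by rewrite (_ : [set _ | _] = setT)//; apply/seteqP; split.
by rewrite (_ : [set _ | _] = set0)//; apply/seteqP; split.
Qed.

End restriction.

Section env_indep.
Variables (R : realType) (d : nat) (P : probability (env R d) R).
Hypothesis iid : iid_env P.
Implicit Types (J : set (int * site d)).
Local Open Scope ereal_scope.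

Let indep_cyl J1 J2 C1 C2 : J1 `&` J2 = set0 -> cylinders C1 -> cylinders C2 ->
  P (restr J1 @^-1` C1 `&` restr J2 @^-1` C2) =
  P (restr J1 @^-1` C1) * P (restr J2 @^-1` C2).
Proof.
move=> J12 [s1 [A1 [mA1 ->]]] [s2 [A2 [mA2 ->]]]; rewrite !restr_preimage.
set s := undup (s1 ++ s2).
have us : uniq s by exact: undup_uniq.
rewrite (@cyl_widen _ _ s1 s) => [|i]; last by rewrite mem_undup mem_cat => ->.
rewrite (@cyl_widen _ _ s2 s) => [|i]; last by rewrite mem_undup mem_cat orbC => ->.
set B1 := fun i => if i \in s1 then _ else _.
set B2 := fun i => if i \in s2 then _ else _.
have mB1 i : measurable (B1 i) by apply: measurable_if_setT; exact: measurable_restr_ev.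
have mB2 i : measurable (B2 i) by apply: measurable_if_setT; exact: measurable_restr_ev.
rewrite cylI iid.1//; last by move=> i; exact: measurableI.
rewrite iid.1// iid.1// -big_split/=; apply: eq_bigr => i _.
(* A site lies outside [J1] or outside [J2], so one of its two events is empty or full, and the
   factorization holds site by site. *)
have triv (J : set (int * site d)) (s' : seq (int * site d)) A : ~ J i ->
    (if i \in s' then restr_ev J A i else setT) = set0 \/
    (if i \in s' then restr_ev J A i else setT) = [set: prob_vector R d].
  move=> Ji; case: ifP => _; last by right.
  rewrite /restr_ev; case: (pselect (J i)) => //= _.
  by case: (pselect (A i point)) => _ /=; [right|left].
have PT : P [set _ | True] = 1 by exact: probability_setT.
have P0 (C : set (env R d)) : C `<=` set0 -> P C = 0.
  by move=> C0; rewrite (_ : C = set0) ?measure0//; apply/seteqP; split.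
have [J1i|J1i] := pselect (J1 i).
  have J2i : ~ J2 i by move=> J2i; have : (J1 `&` J2) i by []; rewrite J12.
  rewrite /B2; case: (triv J2 s2 A2 J2i) => ->.
    by rewrite [LHS]P0 => [|w []//]; rewrite [X in _ * X]P0 ?mule0.
  rewrite PT mule1; congr (P _).
  by apply/seteqP; split => w //= -[].
rewrite /B1; case: (triv J1 s1 A1 J1i) => ->.
  by rewrite [LHS]P0 => [|w []//]; rewrite [X in X * _]P0 ?mul0e.
rewrite PT mul1e; congr (P _).
by apply/seteqP; split => w //= -[].
Qed.

(** A pi-lambda argument for one event at a time: with the other event fixed, both sides are finite
    measures in this one and agree on cylinders. *)
Lemma restr_indep J1 J2 A B : J1 `&` J2 = set0 -> measurable A -> measurable B ->
  P (restr J1 @^-1` A `&` restr J2 @^-1` B) =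
  P (restr J1 @^-1` A) * P (restr J2 @^-1` B).
Proof.
move=> J12 mA mB.
have mres J (C : set (env R d)) : measurable C -> measurable (restr J @^-1` C).
  by move=> mC; rewrite -[X in measurable X]setTI; exact: measurable_restr.
have key J (D : set (env R d)) : measurable D ->
   (forall C, cylinders C -> P (restr J @^-1` C `&` D) = P (restr J @^-1` C) * P D) ->
   forall C, measurable C -> P (restr J @^-1` C `&` D) = P (restr J @^-1` C) * P D.
  move=> mD h C mC.
  pose PD : {nonneg R} := NngNum (fine_ge0 (measure_ge0 P D)).
  pose m1 := measure_function_pushforward__canonical__measure_function_Measure
    (mrestr P mD) (@measurable_restr R d J).
  pose m2 := mscale PD (measure_function_pushforward__canonical__measure_function_Measure
    P (@measurable_restr R d J)).
  have PDE : (PD%:num)%:E = P D by rewrite /= fineK// fin_num_measure.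
  have : m1 C = m2 C.
    apply: (@eq_on_cylinders R d m1 m2) => //.
      by rewrite /= /pushforward /mrestr (le_lt_trans (probability_le1 _ _))// ?ltry//
        ?preimage_setT ?setTI.
    move=> C' cC'; rewrite /m1 /m2 /= /mscale /pushforward /mrestr PDE muleC; exact: h.
  by rewrite /m1 /m2 /= /mscale /pushforward /mrestr PDE muleC.
apply: (key J1) => //; first exact: mres.
move=> C cC; rewrite setIC muleC.
apply: (key J2) => //; first by apply: mres; exact: cylinders_measurable.
by move=> C' cC'; rewrite setIC muleC; exact: indep_cyl.
Qed.

Definition dep J (f : env R d -> R) :=
  measurable_fun setT f /\ forall w, f (restr J w) = f w.

Lemma dep_indep J1 J2 f g : J1 `&` J2 = set0 -> dep J1 f -> dep J2 g ->
  (forall w, 0 <= f w)%R -> (forall w, 0 <= g w)%R ->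
  \int[P]_w (f w * g w)%:E = \int[P]_w (f w)%:E * \int[P]_w (g w)%:E.
Proof.
move=> J12 [mf fJ] [mg gJ] f0 g0.
under eq_integral do rewrite -fJ -gJ.
under [X in X * _]eq_integral do rewrite -fJ.
under [X in _ * X]eq_integral do rewrite -gJ.
apply: expectation_mul_indep => //; try exact: measurable_restr.
by move=> A B mA mB; exact: restr_indep.
Qed.

End env_indep.

(** * Unit steps and the inner product *)

Section steps.
Variable d : nat.

Definition step : finType := ('I_d * bool)%type.

Definition st (s : step) : site d := (-1) ^+ s.2 *: delta_mx 0 s.1.

Lemma st_inj : injective st.
Proof.
move=> [i a] [j b] /rowP h.
move: (h i) (h j); rewrite !mxE !eqxx/= => {h}.
by case: (eqVneq j i) => [->|ji]; case: a; case: b => /=; rewrite ?eqxx//= ?(eq_sym i) ?(negbTE ji).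
Qed.

Variable R : realType.
Implicit Types (x y : 'rV[R]_d) (z : site d).

Lemma dotDl x x' y : dot (x + x') y = dot x y + dot x' y.
Proof. by rewrite /dot -big_split; apply: eq_bigr => i _; rewrite mxE mulrDl. Qed.

Lemma dotC x y : dot x y = dot y x.
Proof. by apply: eq_bigr => i _; rewrite mulrC. Qed.

Lemma dotDr x y y' : dot x (y + y') = dot x y + dot x y'.
Proof. by rewrite !(dotC x) dotDl. Qed.

Lemma dotZl a x y : dot (a *: x) y = a * dot x y.
Proof. by rewrite /dot mulr_sumr; apply: eq_bigr => i _; rewrite mxE mulrA. Qed.

Lemma dotZr a x y : dot x (a *: y) = a * dot x y.
Proof. by rewrite dotC dotZl dotC. Qed.

Lemma dotNl x y : dot (- x) y = - dot x y.
Proof. by rewrite -scaleN1r dotZl mulN1r. Qed.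

Lemma dotNr x y : dot x (- y) = - dot x y.
Proof. by rewrite dotC dotNl dotC. Qed.

Lemma dotBl x x' y : dot (x - x') y = dot x y - dot x' y.
Proof. by rewrite dotDl dotNl. Qed.

Lemma dotBr x y y' : dot x (y - y') = dot x y - dot x y'.
Proof. by rewrite dotDr dotNr. Qed.

Lemma dot0l y : dot 0 y = 0.
Proof. by rewrite -(scale0r 0) dotZl mul0r. Qed.

Lemma dot0r x : dot x 0 = 0.
Proof. by rewrite dotC dot0l. Qed.

Lemma dot_sumr (I : finType) x (F : I -> 'rV[R]_d) :
  dot x (\sum_i F i) = \sum_i dot x (F i).
Proof.
exact: (big_morph (dot x) (dotDr x) (dot0r x)).
Qed.

Lemma embedD z z' : embed R (z + z') = embed R z + embed R z'.
Proof. by rewrite /embed map_mxD. Qed.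

Lemma embedB z z' : embed R (z - z') = embed R z - embed R z'.
Proof. by rewrite /embed map_mxB. Qed.

Lemma embed0 : embed R (0 : site d) = 0.
Proof. by apply/rowP => i; rewrite !mxE. Qed.

Lemma embed_st s i : embed R (st s) 0 i = (-1) ^+ s.2 * (i == s.1)%:R.
Proof.
by rewrite /embed !mxE eqxx/= intrM rmorphXn/= rmorphN1; case: eqP.
Qed.

Lemma dot_st x s : dot x (embed R (st s)) = (-1) ^+ s.2 * x 0 s.1.
Proof.
rewrite /dot (bigD1 s.1)//= embed_st eqxx mulr1 mulrC big1 ?addr0// => i /negbTE si.
by rewrite embed_st si !mulr0.
Qed.

(** The norm is the sup norm, for which this bound carries no factor of the dimension. Tilts are
    measured in it throughout, while the neighbourhood of the theorem is Euclidean. *)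
Lemma norm_dot_st x s : `|dot x (embed R (st s))| <= `|x|.
Proof.
rewrite dot_st normrM normrX normrN1 expr1n mul1r.
rewrite [leRHS]mx_normrE; exact: (le_bigmax _ (fun ij => `|x ij.1 ij.2|) (0, s.1)).
Qed.

Lemma unit_stepsE : unit_steps R d = range st.
Proof.
apply/seteqP; split => [z z1|_ [s _ <-]]; last first.
  rewrite /unit_steps/= /enorm dot_st embed_st eqxx mulr1 -expr2 sqrr_sign.
  by rewrite sqrtr1.
have dz0 : 0 <= dot (embed R z) (embed R z).
  by apply: sumr_ge0 => k _; exact: sqr_ge0.
have : dot (embed R z) (embed R z) = 1.
  by rewrite -(sqr_sqrtr dz0) -/(enorm _) z1 expr1n.
have -> : dot (embed R z) (embed R z) = (\sum_i z 0 i ^+ 2)%:~R.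
  by rewrite rmorph_sum/=; apply: eq_bigr => i _; rewrite !mxE expr2 intrM.
move=> /eqP; rewrite (eqr_int _ _ 1) => /eqP sz.
have [i zi] : exists i, z 0 i != 0.
  apply/existsP; apply: contraPT sz => /existsPn h; rewrite big1// => i _.
  by have := h i; rewrite negbK => /eqP ->.
move: sz; rewrite (bigD1 i)//=; set S := \sum_(_ | _) _ => sz.
have S0 : 0 <= S by apply: sumr_ge0 => k _; exact: sqr_ge0.
have zi1 : 1 <= z 0 i ^+ 2 by rewrite -gtz0_ge1 exprn_even_gt0.
have Sz : S = 0 by lia.
have zj j : j != i -> z 0 j = 0.
  move=> ji; move/eqP: Sz; rewrite psumr_eq0 => [/allP/(_ j)|k _]; last exact: sqr_ge0.
  by rewrite mem_index_enum ji sqrf_eq0 => /(_ isT)/eqP.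
have zi2 : z 0 i = 1 \/ z 0 i = -1 by nia.
case: zi2 => e; [exists (i, false)|exists (i, true)] => //;
  apply/rowP => j; rewrite !mxE/=; case: (eqVneq j i) => [->|/zj ->]; rewrite ?e ?mulr0//=.
Qed.

Lemma sum_unit_steps (V : nmodType) (F : site d -> V) :
  \sum_(z \in unit_steps R d) F z = \sum_s F (st s).
Proof.
rewrite unit_stepsE fsbig_image; last by move=> ? ? _ _; exact: st_inj.
rewrite [RHS]fsbig_seq ?index_enum_uniq//.
by apply: eq_fsbigl; apply/seteqP; split => x //= _; rewrite mem_index_enum.
Qed.

Variable p : prob_vector R d.

Let esum_st : \esum_(z in range st) (p z)%:E = (\sum_s p (st s))%:E.
Proof.
rewrite esum_image; last by move=> ? ? _ _; exact: st_inj.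
rewrite esum_fset => [||i _]; last first.
- by rewrite lee_fin prob_vector_ge0.
- exact: finite_finset.
rewrite -sumEFin [RHS]fsbig_seq ?index_enum_uniq//.
by apply: eq_fsbigl; apply/seteqP; split => x //= _; rewrite mem_index_enum.
Qed.

Lemma prob_vector_sum_le1 : \sum_s p (st s) <= 1.
Proof.
rewrite -lee_fin -esum_st -(prob_vector_sum1 p).
rewrite [leRHS](esumID (range st)) => [|y _]; last by rewrite lee_fin prob_vector_ge0.
rewrite setTI leeDl//.
by apply: esum_ge0 => y _; rewrite lee_fin prob_vector_ge0.
Qed.

Lemma prob_vector_sum_st : (forall z, ~ unit_steps R d z -> p z = 0) ->
  \sum_s p (st s) = 1.
Proof.
move=> p0; have : (\sum_s p (st s))%:E = 1%E; last by case.
rewrite -esum_st -(prob_vector_sum1 p).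
rewrite [RHS](esumID (range st)) => [|y _]; last by rewrite lee_fin prob_vector_ge0.
rewrite setTI [X in _ = (_ + X)%E]esum1 ?adde0// => z [_ zU].
by rewrite p0// unit_stepsE.
Qed.

Lemma prob_vector_le1 s : p (st s) <= 1.
Proof.
apply: le_trans prob_vector_sum_le1; rewrite (bigD1 s)//= lerDl.
by apply: sumr_ge0 => *; exact: prob_vector_ge0.
Qed.

End steps.

(** * Sums over paths *)

Section iter_kernel.
Variables (R : realType) (d : nat).
Implicit Types (K : nat -> site d -> step d -> R) (g : site d -> R).

(* Backward recursion: the sum over [n]-step paths from [(t, x)] of the product
   of the kernels along the path times [g] at the endpoint. *)
Fixpoint iterK K g n t x : R :=
  if n is m.+1 then \sum_s K t x s * iterK K g m t.+1 (x + st s) else g x.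

Lemma iterK_ge0 K g n t x : (forall t x s, 0 <= K t x s) -> (forall x, 0 <= g x) ->
  0 <= iterK K g n t x.
Proof.
move=> K0 g0; elim: n t x => [|n ih] t x //=.
by apply: sumr_ge0 => s _; rewrite mulr_ge0.
Qed.

(** The one comparison principle behind monotonicity in [g], the ellipticity bound of the averaged
    start and the change from one tilt to another: a factor [c] is paid at each step. *)
Lemma le_iterK K K' c g g' n t x : 0 <= c ->
  (forall t x s, 0 <= K t x s <= c * K' t x s) -> (forall x, 0 <= g x <= g' x) ->
  iterK K g n t x <= c ^+ n * iterK K' g' n t x.
Proof.
move=> c0 KK' gg'; elim: n t x => [|n ih] t x /=.
  by rewrite expr0 mul1r; have /andP[] := gg' x.
rewrite exprS -mulrA 2!mulr_sumr; apply: ler_sum => s _.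
have /andP[K0 KK] := KK' t x s.
rewrite [leRHS](_ : _ = c * K' t x s * (c ^+ n * iterK K' g' n t.+1 (x + st s))); last by ring.
apply: ler_pM => //; apply: iterK_ge0 => [t' x' s'|y].
  by have /andP[] := KK' t' x' s'.
by have /andP[] := gg' y.
Qed.

Lemma iterK_comp K g m n t x :
  iterK K g (m + n) t x = iterK K (iterK K g n (t + m)%N) m t x.
Proof.
elim: m t x => [|m ih] t x /=; first by rewrite addn0.
by apply: eq_bigr => s _; rewrite ih addSnnS.
Qed.

Lemma eq_iterK K K' g g' n t x : (forall t x s, K t x s = K' t x s) -> g =1 g' ->
  iterK K g n t x = iterK K' g' n t x.
Proof.
move=> KK gg; elim: n t x => [|n ih] t x /=; first exact: gg.
by apply: eq_bigr => s _; rewrite KK ih.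
Qed.

Lemma iterKZ K a g n t x : iterK K (fun y => a * g y) n t x = a * iterK K g n t x.
Proof.
elim: n t x => [|n ih] t x //=; rewrite mulr_sumr.
by apply: eq_bigr => s _; rewrite ih mulrCA.
Qed.

Lemma iterKD K g g' n t x :
  iterK K (fun y => g y + g' y) n t x = iterK K g n t x + iterK K g' n t x.
Proof.
elim: n t x => [|n ih] t x //=; rewrite -big_split/=.
by apply: eq_bigr => s _; rewrite ih mulrDr.
Qed.

Lemma iterK_sum K (I : finType) (G : I -> site d -> R) n t x :
  iterK K (fun y => \sum_i G i y) n t x = \sum_i iterK K (G i) n t x.
Proof.
elim: n t x => [|n ih] t x //=; rewrite exchange_big/=.
by apply: eq_bigr => s _; rewrite ih mulr_sumr.
Qed.

(** The exponential of the endpoint is that of the starting point times one factor per step, which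
    is moved into the kernel. The normalization [a] will be [mgf P th]. *)
Lemma iterK_tilt K (th : 'rV[R]_d) a g n t x : a != 0 ->
  iterK K (fun y => expR (dot th (embed R y)) * g y) n t x =
  a ^+ n * expR (dot th (embed R x)) *
  iterK (fun t x s => K t x s * expR (dot th (embed R (st s))) / a) g n t x.
Proof.
move=> a0; elim: n t x => [|n ih] t x /=; first by rewrite expr0 mul1r.
rewrite mulr_sumr; apply: eq_bigr => s _.
by rewrite ih embedD dotDr expRD exprS; field.
Qed.

End iter_kernel.

(** * Means of nonnegative functions, Markov and Chebyshev bounds *)

Section nonneg_expectation.
Context d (T : measurableType d) (R : realType) (P : probability T R).
Local Open Scope ereal_scope.
Implicit Types f g : T -> R.

Definition mean f : \bar R := \int[P]_w (f w)%:E.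

Definition nonneg_mfun f := measurable_fun setT f /\ forall w, (0 <= f w)%R.

Lemma nnm_cst a : (0 <= a)%R -> nonneg_mfun (fun=> a).
Proof. by move=> a0; split => //; exact: measurable_cst. Qed.

Lemma nnmM f g : nonneg_mfun f -> nonneg_mfun g -> nonneg_mfun (fun w => f w * g w)%R.
Proof.
by move=> [mf f0] [mg g0]; split=> [|w]; [exact: measurable_funM|exact: mulr_ge0].
Qed.

Lemma nnm_sum (I : Type) (r : seq I) (f : I -> T -> R) :
  (forall i, nonneg_mfun (f i)) -> nonneg_mfun (fun w => \sum_(i <- r) f i w)%R.
Proof.
move=> h; split=> [|w]; last by apply: sumr_ge0 => i _; exact: (h i).2.
by apply: measurable_sum => i; exact: (h i).1.
Qed.

Lemma mean_ge0 f : nonneg_mfun f -> 0 <= mean f.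
Proof. by move=> [_ f0]; apply: integral_ge0 => w _; rewrite lee_fin. Qed.

Lemma mean_cst a : mean (fun=> a) = a%:E.
Proof.
rewrite /mean (integral_cst P measurableT).
by rewrite [X in _ * X](probability_setT P) mule1.
Qed.

Lemma meanD f g : nonneg_mfun f -> nonneg_mfun g -> mean (fun w => f w + g w)%R = mean f + mean g.
Proof.
move=> [mf f0] [mg g0]; rewrite /mean; under eq_integral do rewrite EFinD.
apply: ge0_integralD => //.
- by move=> w _; rewrite lee_fin.
- exact/measurable_EFinP.
- by move=> w _; rewrite lee_fin.
- exact/measurable_EFinP.
Qed.

Lemma mean_sum (I : Type) (r : seq I) (f : I -> T -> R) :
  (forall i, nonneg_mfun (f i)) ->
  mean (fun w => \sum_(i <- r) f i w)%R = \sum_(i <- r) mean (f i).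
Proof.
move=> h; rewrite /mean; under eq_integral do rewrite -sumEFin.
rewrite ge0_integral_sum// => [i|i w _]; last by rewrite lee_fin; exact: (h i).2.
by apply/measurable_EFinP; exact: (h i).1.
Qed.

Lemma meanZ a f : (0 <= a)%R -> nonneg_mfun f -> mean (fun w => a * f w)%R = a%:E * mean f.
Proof.
move=> a0 [mf f0]; rewrite /mean; under eq_integral do rewrite EFinM.
rewrite ge0_integralZl_EFin// => [w _|]; first by rewrite lee_fin.
exact/measurable_EFinP.
Qed.

Lemma le_mean f g : nonneg_mfun f -> nonneg_mfun g -> (forall w, (f w <= g w)%R) -> mean f <= mean g.
Proof.
move=> [mf f0] [mg g0] fg; apply: ge0_le_integral => //.
- by move=> w _; rewrite lee_fin.
- exact/measurable_EFinP.
- exact/measurable_EFinP.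
- by move=> w _; rewrite lee_fin.
Qed.

Lemma mean_markov f a : nonneg_mfun f -> (0 < a)%R ->
  P [set w | (a <= f w)%R] <= (a^-1)%:E * mean f.
Proof.
move=> [mf f0] a0.
have mA : measurable [set w | (a <= f w)%R].
  by rewrite -[X in measurable X]setTI; apply: measurable_fun_le => //; exact: measurable_cst.
rewrite -[leLHS]mul1e -integral_cst//= -meanZ//; last by rewrite invr_ge0 ltW.
rewrite integral_mkcond; apply: ge0_le_integral => //.
- by move=> w _; rewrite /patch; case: ifP.
- by apply/(measurable_restrictT _ _).1 => //; exact: measurable_cst.
- by apply/measurable_EFinP; apply: measurable_funM => //; exact: measurable_cst.
move=> w _; rewrite /patch; case: ifPn => [|_]; rewrite lee_fin.
  by rewrite inE/= => afw; rewrite mulrC ler_pdivlMr// mul1r.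
by rewrite mulr_ge0// invr_ge0 ltW.
Qed.

(** Chebyshev's inequality: the variance is at most [u], and [f w < 1/2] forces
    [(f w - 1)^2 >= 1/4]. *)
Lemma second_moment_lower f u : nonneg_mfun f -> mean f = 1 ->
  mean (fun w => f w * f w)%R <= (1 + u)%:E -> (0 <= u)%R ->
  P [set w | (f w < 2^-1)%R] <= (4 * u)%:E.
Proof.
move=> nf m1 m2 u0.
pose g w := ((f w - 1) * (f w - 1))%R.
have ng : nonneg_mfun g.
  split=> [|w]; last by rewrite /g -expr2 sqr_ge0.
  have mf1 : measurable_fun setT (fun w => f w - 1)%R.
    by apply: measurable_funB; [exact: nf.1|exact: measurable_cst].
  exact: measurable_funM.
have gu : mean g <= u%:E.
  have n2f : nonneg_mfun (fun w => 2 * f w)%R by apply: nnmM => //; exact: nnm_cst.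
  have nff := nnmM nf nf.
  (* The square is expanded with all terms on the side where they are positive, since additivity is
     at hand for nonnegative functions only. *)
  have : mean (fun w => g w + 2 * f w)%R = mean (fun w => f w * f w + 1)%R.
    by apply: eq_integral => w _; rewrite /g; congr EFin; ring.
  have n1 : nonneg_mfun (fun _ : T => 1%R : R) by apply: nnm_cst.
  rewrite meanD// meanD//.
  rewrite meanZ// m1 mule1 mean_cst => h.
  have : mean g + 2%:E <= u%:E + 2%:E.
    rewrite h (_ : u%:E + 2%:E = (1 + u)%:E + 1%:E); last by rewrite -!EFinD; congr EFin; ring.
    exact: leeD2r.
  by rewrite leeD2rE.
apply: (@le_trans _ _ (P [set w | (4^-1 <= g w)%R])).
  apply: le_measure; rewrite ?inE.
  - rewrite (_ : [set _ | _] = ~` [set w | (2^-1 <= f w)%R]); last first.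
      by apply/seteqP; split => w /=; rewrite ltNge => /negP.
    apply: measurableC; rewrite -[X in measurable X]setTI.
    by apply: measurable_fun_le => //; exact: nf.1.
  - rewrite -[X in measurable X]setTI.
    by apply: measurable_fun_le => //; exact: ng.1.
  move=> w /= fw; rewrite /g; nra.
apply: (le_trans (mean_markov ng _)); first by rewrite invr_gt0.
by rewrite invrK EFinM lee_pmul2l// lte_fin.
Qed.

End nonneg_expectation.

Lemma ae_forall_count d (T : measurableType d) (R : realType)
    (mu : {measure set T -> \bar R}) (I : countType) (Q : I -> T -> Prop) :
  (forall i, {ae mu, forall w, Q i w}) -> {ae mu, forall w, forall i, Q i w}.
Proof.
move=> h; pose Q' n w := if unpickle n is Some i then Q i w else True.
have : {ae mu, forall w, forall n, Q' n w}.
  apply/ae_foralln => n; rewrite /Q'; case: unpickle => [i|]; first exact: h.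
  exact: aeW.
by apply: filterS => w hw i; have := hw (pickle i); rewrite /Q' pickleK.
Qed.

(** * Moments of one site, and the assumptions at all sites *)

Section model.
Variables (R : realType) (d : nat) (P : probability (env R d) R).
Hypothesis iid : iid_env P.
Local Open Scope ereal_scope.
Local Notation mean := (mean P).

Lemma measurable_prob_vector z : measurable_fun setT (fun p : prob_vector R d => p z).
Proof.
move=> _ A mA; rewrite setTI; apply: sub_sigma_algebra.
by exists z => //; exists A => //; rewrite setTI.
Qed.

Lemma nnm_coord n x z : nonneg_mfun (fun w : env R d => w n x z).
Proof.
split=> [|w]; last exact: prob_vector_ge0.
exact: (measurableT_comp (measurable_prob_vector z) (@measurable_coord R d (n, x))).
Qed.

Lemma mean_shift (g : prob_vector R d -> R) (i j : int * site d) :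
  measurable_fun setT g -> (forall p, 0 <= g p)%R ->
  mean (fun w => g (w i.1 i.2)) = mean (fun w => g (w j.1 j.2)).
Proof.
move=> mg g0.
pose X k : {mfun env R d >-> prob_vector R d} :=
  HB.pack (fun w : env R d => w k.1 k.2)
    (isMeasurableFun.Build _ _ _ _ _ (@measurable_coord R d k)).
have h k : mean (fun w => g (w k.1 k.2)) = \int[distribution P (X k)]_p (g p)%:E.
  by rewrite ge0_integral_distribution//; exact/measurable_EFinP.
rewrite !h; apply: eq_measure_integral => A mA _.
exact: iid.2.
Qed.

Definition q (s : step d) : R := mean_step P (st s).

Lemma mean_coord n x s : mean (fun w => w n x (st s)) = (q s)%:E.
Proof.
rewrite (mean_shift (n, x) (0%R, 0%R) (measurable_prob_vector _))//=; last first.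
  by move=> p; exact: prob_vector_ge0.
rewrite /q /mean_step expectation.unlock fineK//.
have := le_mean P (nnm_coord 0 0 (st s)) (nnm_cst _ ler01) (fun w => prob_vector_le1 (w 0%R 0%R) s).
rewrite mean_cst => h; rewrite ge0_fin_numE ?(le_lt_trans h) ?ltry//.
exact: (mean_ge0 _ (nnm_coord 0 0 (st s))).
Qed.

Definition q2 (s s' : step d) : R :=
  fine (mean (fun w => w 0 0 (st s) * w 0 0 (st s'))%R).

Lemma mean_coord2 n x s s' : mean (fun w => w n x (st s) * w n x (st s'))%R = (q2 s s')%:E.
Proof.
rewrite (mean_shift (g := fun p => p (st s) * p (st s'))%R (n, x) (0%R, 0%R))//=; last 2 first.
- by apply: measurable_funM; exact: measurable_prob_vector.
- by move=> p; rewrite mulr_ge0// prob_vector_ge0.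
rewrite /q2 fineK//.
have nn := nnmM (nnm_coord 0 0 (st s)) (nnm_coord 0 0 (st s')).
have : mean (fun w => w 0 0 (st s) * w 0 0 (st s'))%R <= mean (fun=> 1)%R.
  apply: (le_mean P nn (nnm_cst _ ler01)).
  by move=> w; rewrite mulr_ile1// ?prob_vector_ge0// prob_vector_le1.
rewrite mean_cst => h; rewrite ge0_fin_numE ?(le_lt_trans h) ?ltry//.
exact: mean_ge0.
Qed.

Lemma q_ge0 s : (0 <= q s)%R.
Proof. by rewrite -lee_fin -(mean_coord 0 0) mean_ge0//; exact: nnm_coord. Qed.

Lemma q2_ge0 s s' : (0 <= q2 s s')%R.
Proof.
by rewrite -lee_fin -(mean_coord2 0 0) mean_ge0//; apply: nnmM; exact: nnm_coord.
Qed.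

Lemma sum_q2_le1 : (\sum_s \sum_s' q2 s s' <= 1)%R.
Proof.
rewrite -lee_fin -sumEFin.
have -> : \sum_s (\sum_s' q2 s s')%R%:E =
    mean (fun w => \sum_s \sum_s' (w 0 0 (st s) * w 0 0 (st s')))%R.
  rewrite mean_sum => [|s]; last first.
    by apply: nnm_sum => s'; apply: nnmM; exact: nnm_coord.
  apply: eq_bigr => s _; rewrite mean_sum => [|s']; last by apply: nnmM; exact: nnm_coord.
  by rewrite -sumEFin; apply: eq_bigr => s' _; rewrite mean_coord2.
rewrite -(mean_cst P 1); apply: le_mean => [||w].
- by do 2 apply: nnm_sum => ?; apply: nnmM; exact: nnm_coord.
- exact: nnm_cst.
under eq_bigr do rewrite -mulr_sumr.
rewrite -mulr_suml mulr_ile1// ?prob_vector_sum_le1//;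
  by apply: sumr_ge0 => *; exact: prob_vector_ge0.
Qed.

Definition good (c : R) (w : env R d) : Prop :=
  forall n x, (forall z, ~ unit_steps R d z -> w n x z = 0%R) /\
              (forall s, (c <= w n x (st s))%R).

(** The assumptions concern the origin at time 0. Identical distribution carries them to each site,
    and countability gives one null set for all sites. *)
Lemma good_ae : nearest_neighbor P -> uniformly_elliptic P ->
  exists2 c : R, (0 < c)%R & {ae P, forall w, good c w}.
Proof.
move=> nn [c c0 ue]; exists c => //.
have mle0 n x z : measurable [set w : env R d | (0 < w n x z)%R].
  rewrite (_ : [set _ | _] = ~` [set w : env R d | (w n x z <= 0)%R]); last first.
    by apply/seteqP; split => w /=; rewrite ltNge => /negP.
  apply: measurableC; rewrite -[X in measurable X]setTI.
  by apply: measurable_fun_le => //; exact: (nnm_coord _ _ _).1.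
have mlec n x z : measurable [set w : env R d | (c <= w n x z)%R].
  rewrite -[X in measurable X]setTI.
  by apply: measurable_fun_le => //; exact: (nnm_coord _ _ _).1.
have e0 n x z : ~ unit_steps R d z -> {ae P, forall w : env R d, w n x z = 0%R}.
  move=> zU; exists [set w : env R d | (0 < w n x z)%R]; split => //.
    have mA : measurable [set p : prob_vector R d | (0 < p z)%R].
      rewrite (_ : [set _ | _] = (fun p : prob_vector R d => p z) @^-1` `]0%R, +oo[); last first.
        by apply/seteqP; split => p /=; rewrite in_itv/= andbT.
      by rewrite -[X in measurable X]setTI; exact: measurable_prob_vector.
    by rewrite (iid.2 (n, x) (0%R, 0%R) _ mA)//; exact: nn.
  move=> w /= wz; rewrite lt_neqAle prob_vector_ge0 andbT eq_sym.
  by apply/eqP.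
have e1 n x s : {ae P, forall w : env R d, (c <= w n x (st s))%R}.
  exists (~` [set w : env R d | (c <= w n x (st s))%R]); split => //.
    exact: measurableC.
  rewrite probability_setC//.
  have mA : measurable [set p : prob_vector R d | (c <= p (st s))%R].
    rewrite (_ : [set _ | _] = (fun p : prob_vector R d => p (st s)) @^-1` `[c, +oo[); last first.
      by apply/seteqP; split => p /=; rewrite in_itv/= andbT.
    by rewrite -[X in measurable X]setTI; exact: measurable_prob_vector.
  rewrite (iid.2 (n, x) (0%R, 0%R) _ mA)//= ue ?subee//.
  by rewrite unit_stepsE; exists s.
have h0 : {ae P, forall w : env R d, forall i : int * site d * site d,
    ~ unit_steps R d i.2 -> w i.1.1 i.1.2 i.2 = 0%R}.
  apply: ae_forall_count => -[[n x] z] /=.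
  have [zU|zU] := pselect (unit_steps R d z); first exact: aeW.
  by have := e0 n x z zU; apply: filterS => w wz _.
have h1 : {ae P, forall w : env R d, forall i : int * site d * step d,
    (c <= w i.1.1 i.1.2 (st i.2))%R}.
  by apply: ae_forall_count => -[[n x] s] /=; exact: e1.
apply: filterS2 h0 h1 => w w0 w1 n x; split=> [z|s]; first exact: (w0 (n, x, z)).
exact: (w1 (n, x, s)).
Qed.

End model.

(** * First and second moments of the partition function *)

Section second_moment.
Variables (R : realType) (d : nat) (P : probability (env R d) R).
Hypothesis iid : iid_env P.
Variable T : step d -> R.
Hypothesis T_ge0 : forall s, 0 <= T s.

Local Notation mean := (mean P).
Local Notation q := (q P).
Local Notation q2 := (q2 P).

Definition env_kernel (w : env R d) (t : nat) x s : R := w t%:Z x (st s) * T s.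
Definition partfun (w : env R d) (m t : nat) x : R := iterK (env_kernel w) (fun=> 1) m t x.
Definition mean_kernel (_ : nat) (_ : site d) (s : step d) : R := q s * T s.

Definition future (t : nat) : set (int * site d) := [set i | t%:Z <= i.1].

Lemma nnm_tk t x s : nonneg_mfun (fun w => env_kernel w t x s).
Proof. by apply: nnmM; [exact: nnm_coord|exact: nnm_cst]. Qed.

Lemma nnm_pf m t x : nonneg_mfun (fun w => partfun w m t x).
Proof.
rewrite /partfun; elim: m t x => [|m ih] t x /=; first exact: nnm_cst.
by apply: nnm_sum => s; apply: nnmM => //; exact: nnm_tk.
Qed.

Lemma nnm_iterK K (g : env R d -> site d -> R) n t x :
  (forall t x s, 0 <= K t x s) -> (forall x, nonneg_mfun (fun w => g w x)) ->
  nonneg_mfun (fun w => iterK K (g w) n t x).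
Proof.
move=> K0 gn; elim: n t x => [|n ih] t x //=.
by apply: nnm_sum => s; apply: nnmM => //; exact: nnm_cst.
Qed.

Lemma pf_restr m t x w : partfun (restr (future t) w) m t x = partfun w m t x.
Proof.
suff : forall t' x, (t <= t')%N -> partfun (restr (future t) w) m t' x = partfun w m t' x.
  by apply.
rewrite /partfun; elim: m => [|m ih] t' x' tt' //=.
apply: eq_bigr => s _; rewrite ih ?(leq_trans tt')//; congr (_ * _ * _).
by rewrite (@restr_coord _ _ _ _ (t'%:Z, x')).
Qed.

Lemma dep_pf m t x : dep (future t) (fun w => partfun w m t x).
Proof. by split=> [|w]; [exact: (nnm_pf _ _ _).1|exact: pf_restr]. Qed.

Lemma dep_pf2 m t x y : dep (future t) (fun w => partfun w m t x * partfun w m t y).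
Proof.
split=> [|w]; last by rewrite !pf_restr.
by apply: measurable_funM; exact: (nnm_pf _ _ _).1.
Qed.

Lemma dep_coord n x z : dep [set (n, x)] (fun w : env R d => w n x z).
Proof.
split=> [|w]; first exact: (@nnm_coord R d n x z).1.
by rewrite (@restr_coord _ _ _ _ (n, x)).
Qed.

Lemma dep_coord2 n x z y z' :
  dep [set i | i = (n, x) \/ i = (n, y)] (fun w : env R d => w n x z * w n y z').
Proof.
split=> [|w].
  exact: (nnmM (@nnm_coord R d n x z) (@nnm_coord R d n y z')).1.
rewrite (@restr_coord _ _ _ _ (n, x))/=; last by left.
by rewrite (@restr_coord _ _ _ _ (n, y))//=; right.
Qed.

Lemma mean_indep J1 J2 f g : J1 `&` J2 = set0 -> dep J1 f -> dep J2 g ->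
  nonneg_mfun f -> nonneg_mfun g -> mean (fun w => f w * g w) = (mean f * mean g)%E.
Proof.
move=> J12 fJ gJ nf ng.
by apply: (dep_indep iid J12 fJ gJ); [exact: nf.2|exact: ng.2].
Qed.

Lemma mean_coord_neq n x y s s' : x != y ->
  mean (fun w => w n x (st s) * w n y (st s')) = (q s * q s')%:E.
Proof.
move=> xy; rewrite (@mean_indep [set (n, x)] [set (n, y)]).
- by rewrite !mean_coord.
- by apply/seteqP; split => // i [/= -> [] yx]; rewrite yx eqxx in xy.
- exact: dep_coord.
- exact: dep_coord.
- exact: nnm_coord.
- exact: nnm_coord.
Qed.

(** The first step reads only the site [(t, x)] and the remainder only later times, so the two
    factors are independent. *)
Lemma mean_pf m t x : \sum_s q s * T s = 1 -> mean (fun w => partfun w m t x) = 1%E.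
Proof.
move=> q1; rewrite /partfun; elim: m t x => [|m ih] t x /=; first by rewrite mean_cst.
rewrite mean_sum => [|s]; last by apply: nnmM; [exact: nnm_tk|exact: nnm_pf].
rewrite -[in RHS]q1 -sumEFin; apply: eq_bigr => s _.
transitivity (mean (fun w => T s * (w t%:Z x (st s) * partfun w m t.+1 (x + st s)))).
  by congr mean; apply/funext => w; rewrite /env_kernel mulrCA mulrA mulrC mulrA.
rewrite meanZ//; last by apply: nnmM; [exact: nnm_coord|exact: nnm_pf].
rewrite (@mean_indep [set (t%:Z, x)] (future t.+1)).
- by rewrite ih mule1 mean_coord// -EFinM mulrC.
- by apply/seteqP; split => // i [/= ->]; rewrite /future/=; lia.
- exact: dep_coord.
- exact: dep_pf.
- exact: nnm_coord.
- exact: nnm_pf.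
Qed.

Lemma mean_iterK_qk (g : env R d -> site d -> R) n t x : \sum_s q s * T s = 1 ->
  (forall x, nonneg_mfun (fun w => g w x)) -> (forall x, mean (fun w => g w x) = 1%E) ->
  mean (fun w => iterK mean_kernel (g w) n t x) = 1%E.
Proof.
have q0 := q_ge0 iid.
have qk0 t' x' s' : 0 <= mean_kernel t' x' s' by rewrite /mean_kernel mulr_ge0.
move=> q1 gn g1; elim: n t x => [|n ih] t x //=.
rewrite mean_sum => [|s]; last by apply: nnmM; [exact: nnm_cst|exact: nnm_iterK].
rewrite -[in RHS]q1 -sumEFin; apply: eq_bigr => s _.
by rewrite meanZ//; [rewrite ih mule1|exact: nnm_iterK].
Qed.

(** Transition operator of the difference of two independent walks with the averaged kernel
    [q s * T s]. *)
Definition pair_step (h : site d -> R) (x : site d) : R :=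
  \sum_s \sum_s' q s * T s * (q s' * T s') * h (x + st s - st s').

Lemma pair_step_ge0 h x : (forall x, 0 <= h x) -> 0 <= pair_step h x.
Proof.
move=> h0; do 2 apply: sumr_ge0 => ? _; have q0 := q_ge0 iid.
by do ?apply: mulr_ge0.
Qed.

(** Two walks at different sites see independent probability vectors, so their difference moves by
    [pair_step]; at a common site the weights are the joint moments [q2]. A function [h >= 1] that
    decreases under both rules bounds the correlation by induction on [m]. *)
Lemma mean_pf2_le h m t x y : (forall x, 1 <= h x) ->
  (forall x, x != 0 -> pair_step h x <= h x) ->
  \sum_s \sum_s' q2 s s' * T s * T s' * h (st s - st s') <= h 0 ->
  (mean (fun w => partfun w m t x * partfun w m t y)%R <= (h (x - y)%R)%:E)%E.
Proof.
move=> h1 hne h0; have hge0 z : 0 <= h z by apply: le_trans (h1 z).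
have q20 := q2_ge0 iid; have q0 := q_ge0 iid.
elim: m t x y => [|m ih] t x y.
  by rewrite /partfun/= mulr1 mean_cst lee_fin.
pose c s s' := fine (mean (fun w => w t%:Z x (st s) * w t%:Z y (st s'))).
have cE s s' : mean (fun w => w t%:Z x (st s) * w t%:Z y (st s')) = (c s s')%:E /\
    c s s' = if x == y then q2 s s' else q s * q s'.
  rewrite /c; case: eqVneq => [->|xy]; first by rewrite mean_coord2.
  by rewrite mean_coord_neq.
have c0 s s' : 0 <= c s s'.
  by rewrite (cE s s').2; case: ifP => _; [exact: q20|rewrite mulr_ge0].
have nF x' : nonneg_mfun (fun w => partfun w m t.+1 x') by exact: nnm_pf.
have nc x' s : nonneg_mfun (fun w : env R d => w t%:Z x' (st s)) by exact: nnm_coord.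
pose G s s' (w : env R d) := (T s * T s') * ((w t%:Z x (st s) * w t%:Z y (st s')) *
   (partfun w m t.+1 (x + st s) * partfun w m t.+1 (y + st s'))).
have nG s s' : nonneg_mfun (G s s').
  apply: nnmM; first by apply: nnm_cst; exact: mulr_ge0.
  by apply: nnmM; apply: nnmM.
have -> : mean (fun w => partfun w m.+1 t x * partfun w m.+1 t y) =
    mean (fun w => \sum_s \sum_s' G s s' w).
  congr mean; apply/funext => w; rewrite /partfun /= mulr_suml; apply: eq_bigr => s _.
  by rewrite mulr_sumr; apply: eq_bigr => s' _; rewrite /G /env_kernel /partfun; ring.
rewrite mean_sum => [|s]; last by apply: nnm_sum.
under eq_bigr do rewrite mean_sum//.
have mG s s' : (mean (G s s') <=
    (T s * T s' * (c s s' * h (x - y + st s - st s')%R)%R)%:E)%E.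
  rewrite /G meanZ ?mulr_ge0//; last by apply: nnmM; apply: nnmM.
  rewrite [leRHS]EFinM lee_pmul// ?lee_fin ?mulr_ge0//.
    by apply: mean_ge0; apply: nnmM; apply: nnmM.
  rewrite (@mean_indep [set i | i = (t%:Z, x) \/ i = (t%:Z, y)] (future t.+1)).
  - rewrite (cE s s').1 [leRHS]EFinM lee_pmul// ?lee_fin//.
      by apply: mean_ge0; apply: nnmM.
    rewrite (_ : x - y + st s - st s' = x + st s - (y + st s')); first exact: ih.
    by rewrite opprD addrACA addrA.
  - by apply/seteqP; split => // i [/= [] ->]; rewrite /future/=; lia.
  - exact: dep_coord2.
  - exact: dep_pf2.
  - exact: nnmM.
  - exact: nnmM.
apply: (@le_trans _ _ (\sum_s \sum_s'
    (T s * T s' * (c s s' * h (x - y + st s - st s')%R)%R)%:E)%E).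
  by do 2 apply: lee_sum => ? _.
under eq_bigr do rewrite sumEFin.
rewrite sumEFin lee_fin; have [xy|xy] := eqVneq x y.
  rewrite xy subrr; apply: le_trans h0; rewrite le_eqVlt; apply/orP; left; apply/eqP.
  apply: eq_bigr => s _; apply: eq_bigr => s' _.
  by rewrite (cE s s').2 xy eqxx add0r; ring.
apply: (le_trans _ (hne _ _)); last by rewrite subr_eq0.
rewrite le_eqVlt; apply/orP; left; apply/eqP.
apply: eq_bigr => s _; apply: eq_bigr => s' _.
by rewrite (cE s s').2 (negbTE xy); ring.
Qed.

(** The averaged kernel is deterministic and leaves the mean, so the difference moves by [pair_step]
    at every site, the origin included. *)
Lemma mean_iterK_qk2_le (g : env R d -> site d -> R) h n t x y :
  (forall x, nonneg_mfun (fun w => g w x)) -> (forall x, 0 <= h x) ->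
  (forall x y, (mean (fun w => g w x * g w y)%R <= (h (x - y)%R)%:E)%E) ->
  (mean (fun w => iterK mean_kernel (g w) n t x * iterK mean_kernel (g w) n t y)%R <=
    (iter n pair_step h (x - y)%R)%:E)%E.
Proof.
have q0 := q_ge0 iid.
have qk0 t' x' s' : 0 <= mean_kernel t' x' s' by rewrite /mean_kernel mulr_ge0.
move=> gn h0 gh; elim: n t x y => [|n ih] t x y //=.
have it0 z : 0 <= iter n pair_step h z.
  by elim: n z {ih} => [|n ihn] z //=; exact: pair_step_ge0.
have ng' x' : nonneg_mfun (fun w => iterK mean_kernel (g w) n t.+1 x') by exact: nnm_iterK.
pose G s s' (w : env R d) := (q s * T s * (q s' * T s')) *
   (iterK mean_kernel (g w) n t.+1 (x + st s) * iterK mean_kernel (g w) n t.+1 (y + st s')).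
have nG s s' : nonneg_mfun (G s s').
  by apply: nnmM; [apply: nnm_cst; rewrite !mulr_ge0|exact: nnmM].
rewrite (_ : mean _ = mean (fun w => \sum_s \sum_s' G s s' w)); last first.
  congr mean; apply/funext => w; rewrite mulr_suml; apply: eq_bigr => s _.
  by rewrite mulr_sumr; apply: eq_bigr => s' _; rewrite /G /mean_kernel; ring.
rewrite mean_sum => [|s]; last by apply: nnm_sum.
under eq_bigr do rewrite mean_sum//.
rewrite {1}/pair_step.
rewrite -sumEFin; apply: lee_sum => s _.
rewrite -sumEFin; apply: lee_sum => s' _.
rewrite /G meanZ; [|by rewrite !mulr_ge0|exact: nnmM].
rewrite [leRHS]EFinM lee_pmul// ?lee_fin ?mulr_ge0//.
  by apply: mean_ge0; exact: nnmM.
by rewrite (_ : x - y + st s - st s' = x + st s - (y + st s')); [exact: ih|by rewrite opprD addrACA addrA].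
Qed.

End second_moment.

(** * Second moment bound, uniform over small tilts *)

Section tilted_moments.
Variables (R : realType) (d : nat) (P : probability (env R d) R).
Hypothesis iid : iid_env P.
Variable c : R.
Hypothesis c_gt0 : 0 < c.
Hypothesis c_good : {ae P, forall w, good c w}.

Local Notation mean := (mean P).
Local Notation q := (q P).
Local Notation q2 := (q2 P).

Lemma ae_le_mean (f g : env R d -> R) : nonneg_mfun f -> nonneg_mfun g ->
  {ae P, forall w, f w <= g w} -> (mean f <= mean g)%E.
Proof.
move=> [mf f0] [mg g0] fg; apply: ae_ge0_le_integral => //.
- by move=> w _; rewrite lee_fin.
- exact/measurable_EFinP.
- by move=> w _; rewrite lee_fin.
- exact/measurable_EFinP.
by apply: filterS fg => w h _; rewrite lee_fin.
Qed.

Lemma q_ge s : c <= q s.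
Proof.
rewrite -lee_fin -(mean_coord iid 0 0) -(mean_cst P c).
apply: ae_le_mean; [by apply: nnm_cst; exact: ltW|exact: nnm_coord|].
by apply: filterS c_good => w gw; exact: (gw _ _).2.
Qed.

Lemma q_gt0 s : 0 < q s. Proof. exact: lt_le_trans (q_ge s). Qed.

Lemma q2_ge s s' : c * c <= q2 s s'.
Proof.
rewrite -lee_fin -(mean_coord2 iid 0 0) -(mean_cst P (c * c)).
apply: ae_le_mean.
- by apply: nnm_cst; apply: mulr_ge0; exact: ltW.
- by apply: nnmM; exact: nnm_coord.
apply: filterS c_good => w gw.
by apply: ler_pM; [exact: ltW|exact: ltW|exact: (gw _ _).2|exact: (gw _ _).2].
Qed.

Lemma sum_q : \sum_s q s = 1.
Proof.
apply: EFin_inj; rewrite -sumEFin.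
under eq_bigr do rewrite -(mean_coord iid 0 0).
rewrite -mean_sum => [|s]; last exact: nnm_coord.
have ns : nonneg_mfun (fun w : env R d => \sum_s w 0 0 (st s)).
  by apply: nnm_sum => s; exact: nnm_coord.
have n1 : nonneg_mfun (fun w : env R d => 1 : R) by apply: nnm_cst.
rewrite -[RHS](mean_cst P 1); apply/eqP; rewrite eq_le; apply/andP; split;
  apply: ae_le_mean => //; apply: filterS c_good => w gw;
  by rewrite prob_vector_sum_st// => z zU; exact: (gw _ _).1.
Qed.

Implicit Type th : 'rV[R]_d.

Lemma mgfE th : mgf P th = \sum_s q s * expR (dot th (embed R (st s))).
Proof. by rewrite /mgf sum_unit_steps. Qed.

Lemma mgf_gt0 th : 0 < mgf P th.
Proof.
rewrite mgfE lt_neqAle sumr_ge0 ?andbT => [|s _]; last first.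
  by rewrite mulr_ge0 ?expR_ge0// ltW// q_gt0.
rewrite eq_sym; apply/eqP => h0; have /eqP := oner_neq0 R; apply.
rewrite -sum_q big1// => s _; move/eqP : h0.
rewrite psumr_eq0 => [/allP/(_ s)|s' _]; last by rewrite mulr_ge0 ?expR_ge0// ltW// q_gt0.
by rewrite mem_index_enum implyTb mulf_eq0 (gt_eqF (expR_gt0 _)) orbF => /(_ isT)/eqP.
Qed.

Definition tilt th (s : step d) : R := expR (dot th (embed R (st s))) / mgf P th.

Lemma tilt_gt0 th s : 0 < tilt th s.
Proof. by rewrite divr_gt0 ?expR_gt0 ?mgf_gt0. Qed.

Lemma sum_q_tilt th : \sum_s q s * tilt th s = 1.
Proof.
rewrite /tilt; under eq_bigr do rewrite mulrA.
by rewrite -mulr_suml -mgfE divff// gt_eqF// mgf_gt0.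
Qed.

Lemma mgf_bounds th rho : `|th| <= rho -> expR (- rho) <= mgf P th <= expR rho.
Proof.
move=> thr; rewrite mgfE -[expR (- rho)]mul1r -[expR rho]mul1r -sum_q !mulr_suml.
apply/andP; split; apply: ler_sum => s _; rewrite ler_pM2l ?q_gt0// ler_expR;
  have := le_trans (norm_dot_st th s) thr; rewrite ler_norml => /andP[]//.
Qed.

Lemma tilt_bounds th rho s : `|th| <= rho ->
  expR (- (2 * rho)) <= tilt th s <= expR (2 * rho).
Proof.
move=> thr; have /andP[m1 m2] := mgf_bounds thr.
have := le_trans (norm_dot_st th s) thr; rewrite ler_norml => /andP[t1 t2].
apply/andP; split.
  rewrite ler_pdivlMr ?mgf_gt0//.
  apply: (@le_trans _ _ (expR (- (2 * rho)) * expR rho)).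
    by rewrite ler_pM2l ?expR_gt0.
  by rewrite -expRD ler_expR; lra.
rewrite ler_pdivrMr ?mgf_gt0//.
apply: (@le_trans _ _ (expR (2 * rho) * expR (- rho))).
  by rewrite -expRD ler_expR; lra.
by rewrite ler_pM2l ?expR_gt0.
Qed.

(** [lyapunov] is applied to pairs of steps, with the exchange of the two walks as symmetry. Then
    [1 + f] decreases off the origin. At the origin [q2] has total mass at most 1 and gives at least
    [c * c] to the opposite pair [i0], where [f] is smaller than 1 by [gap]. *)
Lemma lyapunov_pair : (3 <= d)%N ->
  exists (f : site d -> R) (gamma dl : R),
  [/\ 0 < gamma, 0 < dl, forall x, 0 < f x <= 1 &
   forall T : step d -> R, (forall s, 0 <= T s) -> \sum_s q s * T s = 1 ->
     (forall s s', (1 + dl)^-1 <= T s * T s' <= 1 + dl) ->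
     (forall x, pair_step P T f x <= f x - gamma * f x ^+ 5) /\
     (forall m t x y, (mean (fun w => partfun T w m t x * partfun T w m t y)%R <=
        (1 + f (x - y)%R)%:E)%E)].
Proof.
move=> d3.
pose I : finType := (step d * step d)%type.
pose w (i : I) := embed R (st i.1 - st i.2).
pose p0 (i : I) := q i.1 * q i.2.
pose sigma (i : I) : I := (i.2, i.1).
have p0_gt0 i : 0 < p0 i by rewrite mulr_gt0// q_gt0.
have sK : involutive sigma by case.
have ws i : w (sigma i) = - w i by rewrite /w /sigma !embedB opprB.
have span (v : 'rV[R]_d) : (forall i, v *m (w i)^T = 0) -> v = 0.
  move=> h; apply/rowP => k; rewrite mxE.
  have := h ((k, false), (k, true)); move/matrixP => /(_ 0 0).
  rewrite !mxE (_ : \sum_j _ = dot v (w ((k, false), (k, true)))); last first.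
    by apply: eq_bigr => j _; rewrite mxE.
  rewrite /w embedB dotBr !dot_st/= expr0 expr1; lra.
have [f [gamma [gamma0 f01 f0 flt1 drift]]] := lyapunov d3 p0_gt0 sK ws span.
pose k0 : 'I_d := Ordinal (ltn_trans (isT : 0 < 2)%N d3).
pose i0 : I := ((k0, false), (k0, true)).
have w0 : w i0 != 0.
  have wk : w i0 0 k0 = 2.
    rewrite /w embedB [LHS]mxE [X in _ + X]mxE !embed_st/= ?eqxx expr0 expr1 !mulr1.
    by ring.
  by apply/eqP => w0; move: wk; rewrite w0 mxE; lra.
set gap := 1 - f (w i0).
have gap0 : 0 < gap by rewrite subr_gt0 flt1.
(* The bound [1/100] keeps the tilted weights in the window of [lyapunov]; the other one gives
   [(1 + dl) * (2 - c * c * gap) <= 2], which is the condition at the origin. *)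
have [dl [dl0 dl1 dl2]] : exists dl : R,
    [/\ 0 < dl, dl <= 100^-1 & dl <= c * c * gap / 2].
  exists (Num.min 100^-1 (c * c * gap / 2)); split; last 2 first.
  - by rewrite ge_min lexx.
  - by rewrite ge_min lexx orbT.
  by rewrite lt_min invr_gt0 ltr0n/= divr_gt0// !mulr_gt0.
exists (fun x => f (embed R x)), gamma, dl; split => // T T0 qT TT.
pose p (i : I) := q i.1 * T i.1 * (q i.2 * T i.2).
have pE (F : I -> R) : \sum_i p i * F i =
    \sum_s \sum_s' q s * T s * (q s' * T s') * F (s, s').
  by rewrite pair_bigA; apply: eq_bigr => -[].
have pp : \sum_s \sum_s' q s * T s * (q s' * T s') = 1.
  by under eq_bigr do rewrite -mulr_sumr qT mulr1.
have p1 : \sum_i p i = 1.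
  by rewrite -pp pair_bigA; apply: eq_bigr => -[].
have ps i : p (sigma i) = p i by rewrite /p /sigma/= mulrC.
have pb i : 99 / 100 * p0 i <= p i <= 101 / 100 * p0 i.
  have /andP[t1 t2] := TT i.1 i.2.
  have -> : p i = (T i.1 * T i.2) * p0 i by rewrite /p /p0; ring.
  rewrite !ler_pM2r//; apply/andP; split; last by apply: (le_trans t2); lra.
  apply: le_trans t1; rewrite -[leRHS]mul1r ler_pdivlMr ?addr_gt0//; lra.
have step_le x : pair_step P T (fun x => f (embed R x)) x <=
    f (embed R x) - gamma * f (embed R x) ^+ 5.
  apply: le_trans (drift p p1 ps pb (embed R x)); rewrite pE le_eqVlt; apply/orP; left.
  apply/eqP; apply: eq_bigr => s _; apply: eq_bigr => s' _.
  by rewrite /w/= embedB embedD embedB addrA.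
split=> // m t x y.
pose h x := 1 + f (embed R x).
apply: (@mean_pf2_le _ _ _ iid _ T0 h) => [z|z z0|].
- by rewrite lerDl ltW//; have /andP[] := f01 (embed R z).
- have -> : pair_step P T h z = 1 + pair_step P T (fun x => f (embed R x)) z.
    rewrite /pair_step -[X in X + _]pp -big_split/=; apply: eq_bigr => s _; rewrite -big_split/=.
    by apply: eq_bigr => s' _; rewrite /h mulrDr mulr1.
  rewrite lerD2l; apply: (le_trans (step_le z)).
  by rewrite gerBl mulr_ge0 ?exprn_ge0// ltW//; have /andP[] := f01 (embed R z).
rewrite {2}/h embed0 f0.
have h2 z : h z <= 2 by have /andP[_ ?] := f01 (embed R z); rewrite /h; lra.
have h0 z : 0 <= h z by have /andP[? _] := f01 (embed R z); rewrite /h; lra.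
have q20 := q2_ge0 iid.
apply: (@le_trans _ _ ((1 + dl) * \sum_s \sum_s' q2 s s' * h (st s - st s'))).
  rewrite mulr_sumr; apply: ler_sum => s _; rewrite mulr_sumr; apply: ler_sum => s' _.
  rewrite -mulrA -[X in X <= _]mulrA mulrA.
  have /andP[_ t2] := TT s s'.
  have -> : q2 s s' * T s * (T s' * h (st s - st s')) =
     (T s * T s') * (q2 s s' * h (st s - st s')) by ring.
  by rewrite ler_wpM2r// mulr_ge0.
have S2 : \sum_s \sum_s' q2 s s' * h (st s - st s') <= 2 - c * c * gap.
  pose r (i : I) := q2 i.1 i.2.
  have -> : \sum_s \sum_s' q2 s s' * h (st s - st s') = \sum_i r i * h (st i.1 - st i.2).
    by rewrite pair_bigA.
  have r1 : \sum_i r i <= 1.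
    by have := sum_q2_le1 iid; rewrite pair_bigA.
  apply: (@le_trans _ _ (\sum_i r i * 2 - r i0 * gap)).
    rewrite (bigD1 i0)//= [X in _ <= X - _](bigD1 i0)//= addrAC; apply: lerD.
      by rewrite -mulrBr ler_wpM2l ?q20// /h /gap -/(w i0); lra.
    by apply: ler_sum => i _; rewrite ler_wpM2l// q20.
  rewrite -mulr_suml; apply: lerB; first by rewrite -[leRHS]mul1r ler_pM2r.
  by rewrite ler_pM2r// q2_ge.
apply: (@le_trans _ _ ((1 + dl) * (2 - c * c * gap))).
  by rewrite ler_pM2l// addr_gt0.
have cg : 0 < c * c * gap by rewrite !mulr_gt0.
nra.
Qed.

Lemma lyapunov_tilt : (3 <= d)%N ->
  exists (f : site d -> R) (gamma rho : R),
  [/\ 0 < gamma, 0 < rho, forall x, 0 < f x <= 1 &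
   forall th, `|th| <= rho ->
     (forall x, pair_step P (tilt th) f x <= f x - gamma * f x ^+ 5) /\
     (forall m t x y, (mean (fun w => partfun (tilt th) w m t x * partfun (tilt th) w m t y)%R <=
        (1 + f (x - y)%R)%:E)%E)].
Proof.
move=> /lyapunov_pair[f [gamma [dl [gamma0 dl0 f01 h]]]].
have [rho [rho0 erho]] : exists rho : R,
    0 < rho /\ expR (2 * rho) * expR (2 * rho) = 1 + dl.
  (* Each tilt weight lies within [e^{2 rho}] of 1 as a ratio, hence a product of two within
     [e^{4 rho} = 1 + dl]. *)
  exists (ln (1 + dl) / 4); split; first by rewrite divr_gt0// ln_gt0// ltrDl.
  rewrite -expRD (_ : _ + _ = ln (1 + dl)); last by field.
  by rewrite lnK// posrE addr_gt0.
exists f, gamma, rho; split => // th thr.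
apply: h => [s||s s']; first by rewrite ltW// tilt_gt0.
  exact: sum_q_tilt.
have /andP[a1 a2] := tilt_bounds s thr; have /andP[b1 b2] := tilt_bounds s' thr.
have T0 s0 : 0 <= tilt th s0 := ltW (tilt_gt0 th s0).
apply/andP; split; rewrite -erho.
  rewrite invfM -!expRN; exact: (ler_pM (expR_ge0 _) (expR_ge0 _) a1 b1).
exact: (ler_pM (T0 s) (T0 s') a2 b2).
Qed.

End tilted_moments.

(** * Polynomial decay of the failure probability *)

Lemma borel_cantelli_telescope d (T : measurableType d) (R : realType)
    (P : probability T R) (F : nat -> set T) (C : R) : 0 <= C ->
  (forall j, measurable (F j)) ->
  (forall j, (P (F j) <= (C / (j.+1%:R * j.+2%:R))%:E)%E) ->
  {ae P, forall w, \forall j \near \oo, ~ F j w}.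
Proof.
move=> C0 mF PF.
have sum_le n : (\sum_(0 <= i < n) P (F i) <= C%:E)%E.
  (* The bounds on [P (F j)] telescope to exactly this value. *)
  apply: (@le_trans _ _ (C * (1 - n.+1%:R^-1))%:E); last first.
    by rewrite lee_fin ler_piMr// gerBl invr_ge0.
  elim: n => [|n ih]; first by rewrite big_nil invr1 subrr mulr0.
  rewrite big_nat_recr//=; apply: (le_trans (leeD ih (PF n))).
  rewrite -EFinD lee_fin le_eqVlt; apply/orP; left; apply/eqP.
  have n1 : n.+1%:R != 0 :> R by rewrite pnatr_eq0.
  have n2 : n.+2%:R != 0 :> R by rewrite pnatr_eq0.
  have n21 : n.+2%:R = n.+1%:R + 1 :> R by rewrite -natr1.
  by move: n1 n2; rewrite n21; move: (n.+1%:R : R) => a a0 a1; field; rewrite a0 a1.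
exists (lim_sup_set F); split.
- apply: bigcap_measurable => // k _; exact: bigcup_measurable.
- apply: lim_sup_set_cvg0 => //.
  apply: (@le_lt_trans _ _ C%:E); last by rewrite ltry.
  apply: lime_le; first exact: is_cvg_nneseries.
  by near=> n; exact: sum_le.
move=> w /= h n _; apply: contrapT => h'; apply: h; exists n => // j /= nj Fj.
by apply: h'; exists j.
Unshelve. all: by end_near. Qed.

Section decay.
Variables (R : realType) (d : nat) (P : probability (env R d) R).
Hypothesis iid : iid_env P.
Variable T : step d -> R.
Hypothesis T_ge0 : forall s, 0 <= T s.
Hypothesis qT : \sum_s q P s * T s = 1.
Variables (f : site d -> R) (gamma : R).
Hypothesis gamma_gt0 : 0 < gamma.
Hypothesis f01 : forall x, 0 < f x <= 1.
Hypothesis drift : forall x, pair_step P T f x <= f x - gamma * f x ^+ 5.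
Local Notation L := (pair_step P T).
Implicit Type h : site d -> R.

Let w_ge0 s s' : 0 <= q P s * T s * (q P s' * T s').
Proof. by rewrite !mulr_ge0// (q_ge0 iid). Qed.

Lemma le_pair_step h h' x : (forall x, h x <= h' x) -> L h x <= L h' x.
Proof.
by move=> hh; apply: ler_sum => s _; apply: ler_sum => s' _; rewrite ler_wpM2l.
Qed.

Lemma le_iter_pair_step h h' n x : (forall x, h x <= h' x) ->
  iter n L h x <= iter n L h' x.
Proof. by move=> hh; elim: n x => [|n ih] x //=; exact: le_pair_step. Qed.

Lemma pair_step_affine h a b x : L (fun x => a * h x + b) x = a * L h x + b.
Proof.
rewrite /pair_step -[b in RHS]mulr1.
have <- : \sum_s \sum_s' q P s * T s * (q P s' * T s') = 1.
  by under eq_bigr do rewrite -mulr_sumr qT mulr1.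
rewrite !mulr_sumr -big_split/=; apply: eq_bigr => s _.
rewrite !mulr_sumr -big_split/=; apply: eq_bigr => s' _; ring.
Qed.

Lemma iter_pair_step_affine h a b n x :
  iter n L (fun x => a * h x + b) x = a * iter n L h x + b.
Proof.
elim: n x => [|n ih] x //=; rewrite -pair_step_affine.
by congr (pair_step P T _ x); apply/funext => y; exact: ih.
Qed.

Let u n := iter n L f 0.

Lemma decay_ge0 n : 0 <= u n.
Proof.
rewrite /u; elim: n (0 : site d) => [|n ih] x /=.
  by rewrite ltW//; have /andP[] := f01 x.
exact: pair_step_ge0.
Qed.

(* The tangent line of [t ^+ 5] at [u n] bounds [t ^+ 5] from below, so that
   averaging the drift inequality costs no convexity argument. *)
Lemma decay_step n : u n.+1 <= u n - gamma * u n ^+ 5.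
Proof.
set a := u n; have a0 : 0 <= a by exact: decay_ge0.
have -> : a - gamma * a ^+ 5 = (1 - gamma * 5 * a ^+ 4) * u n + gamma * 4 * a ^+ 5.
  by rewrite -/a; ring.
rewrite -iter_pair_step_affine /u iterSr; apply: le_iter_pair_step => x.
apply: (le_trans (drift x)); set t := f x.
have t0 : 0 <= t by rewrite ltW//; have /andP[] := f01 x.
rewrite -subr_ge0 (_ : _ - _ = gamma * (t ^+ 5 - 5 * a ^+ 4 * t + 4 * a ^+ 5)); last by ring.
apply: mulr_ge0; first exact: ltW.
have -> : t ^+ 5 - 5 * a ^+ 4 * t + 4 * a ^+ 5 =
  (t - a) ^+ 2 * (t ^+ 3 + 2 * t ^+ 2 * a + 3 * t * a ^+ 2 + 4 * a ^+ 3) by ring.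
rewrite mulr_ge0 ?sqr_ge0//.
by rewrite !addr_ge0// ?mulr_ge0// exprn_ge0.
Qed.

Lemma decay_bound n : gamma * n%:R * u n ^+ 5 <= 1.
Proof.
(* The stronger right side carries the induction: [u] decreases, so the left side is at most the sum
   of the [n] drops given by [decay_step], which is at most [u 0 - u n]. *)
suff : gamma * n%:R * u n ^+ 5 <= 1 - u n.
  by move=> /le_trans; apply; rewrite gerBl decay_ge0.
elim: n => [|n ih].
  by rewrite mulr0 mul0r subr_ge0 /u/=; have /andP[] := f01 0.
have s := decay_step n.
have le1 : u n.+1 <= u n.
  by apply: (le_trans s); rewrite gerBl mulr_ge0 ?exprn_ge0 ?decay_ge0// ltW.
apply: (@le_trans _ _ (gamma * n.+1%:R * u n ^+ 5)).
  apply: ler_wpM2l; first by apply: mulr_ge0 => //; exact: ltW.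
  by rewrite ler_pXn2r ?nnegrE ?decay_ge0.
by rewrite -natr1; lra.
Qed.

Hypothesis second_moment : forall m t x y,
  (mean P (fun w => partfun T w m t x * partfun T w m t y)%R <= (1 + f (x - y)%R)%:E)%E.

(* The [k] averaged steps decorrelate the two walks before they meet the
   environment. *)
Lemma averaged_start_lower k m :
  (P [set w : env R d | (iterK (mean_kernel P T) (partfun T w m k) k 0 0 < 2^-1)%R] <= (4 * u k)%:E)%E.
Proof.
apply: second_moment_lower.
- apply: nnm_iterK => [t x s|x]; first by rewrite /mean_kernel mulr_ge0// (q_ge0 iid).
  exact: nnm_pf.
- by apply: mean_iterK_qk => // x; [exact: nnm_pf|exact: mean_pf].
- have -> : 1 + u k = iter k L (fun x => 1 * f x + 1) (0 - 0).
    by rewrite iter_pair_step_affine mul1r addrC subrr.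
  apply: mean_iterK_qk2_le => // [x|x|x y]; first exact: nnm_pf.
    by rewrite mul1r addr_ge0// ltW//; have /andP[] := f01 x.
  by rewrite mul1r addrC.
exact: decay_ge0.
Qed.

Lemma decay_pow j : u (j.+2 ^ 10)%N <= (1 + gamma^-1) / (j.+1%:R * j.+2%:R).
Proof.
(* The fifth root of [gamma^-1] would do; [C] dominates it, because [C >= 1] and [C >= gamma^-1].
   The tenth power in the time becomes a square under the fifth root. *)
set C := 1 + gamma^-1.
have C1 : 1 <= C by rewrite lerDl invr_ge0 ltW.
have C5 : gamma^-1 <= C ^+ 5.
  apply: (@le_trans _ _ C); first by rewrite lerDr.
  by rewrite -[leLHS]expr1 ler_weXn2l.
have j2 : 0 < j.+2%:R :> R by [].
have j1 : 0 < j.+1%:R :> R by [].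
apply: (@le_trans _ _ (C / j.+2%:R ^+ 2)); last first.
  rewrite ler_pM2l ?(lt_le_trans ltr01)// lef_pV2 ?posrE ?mulr_gt0 ?exprn_gt0//.
  by rewrite expr2 ler_pM2r// ler_nat.
rewrite -(@ler_pXn2r _ 5) ?nnegrE ?decay_ge0//; last first.
  by rewrite divr_ge0 ?exprn_ge0// (le_trans ler01).
rewrite expr_div_n ler_pdivlMr ?exprn_gt0//; apply: le_trans C5.
rewrite -[leRHS]mulr1 ler_pdivlMl//; apply: le_trans (decay_bound (j.+2 ^ 10)).
by rewrite -exprM natrX; lra.
Qed.

End decay.

(** * No exponential growth or decay for one tilt *)

Section quenched_growth.
Variables (R : realType) (d : nat) (P : probability (env R d) R).
Hypothesis iid : iid_env P.
Variable c : R.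
Hypothesis c_gt0 : 0 < c.
Hypothesis c_good : {ae P, forall w, good c w}.

(** A quenched step probability is at least [c], hence at least [c * q s], so the first [k] steps
    dominate averaged ones up to [c ^+ k]. *)
Lemma pf_ge_averaged (T : step d -> R) (w : env R d) k m :
  (forall s, 0 <= T s) -> good c w ->
  c ^+ k * iterK (mean_kernel P T) (partfun T w m k) k 0 0 <= partfun T w (k + m) 0 0.
Proof.
move=> T0 gw; have q0 := q_ge0 iid.
rewrite -ler_pdivlMl ?exprn_gt0// -exprVn /partfun iterK_comp add0n.
apply: le_iterK => [|t x s|x].
- by rewrite invr_ge0 ltW.
- rewrite /mean_kernel mulr_ge0//= mulrC -ler_pdivrMl ?invr_gt0// invrK /env_kernel.
  rewrite mulrCA [leRHS]mulrC ler_wpM2l//.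
  apply: le_trans ((gw _ _).2 s); rewrite ler_piMr//; first exact: ltW.
  by rewrite -(sum_q iid c_good) (bigD1 s)//= lerDl sumr_ge0.
- by rewrite lexx (nnm_pf T0 m k x).2.
Qed.

(** Used between two times of the subsequence: the quenched probabilities sum to 1, so [n] more
    steps lose no more than the smallest weight [a] each. *)
Lemma pf_ge_pow (T : step d -> R) (w : env R d) a m n :
  0 <= a -> (forall s, a <= T s) -> good c w ->
  a ^+ n * partfun T w m 0 0 <= partfun T w (m + n) 0 0.
Proof.
move=> a0 aT gw; have T0 s : 0 <= T s by exact: le_trans (aT s).
have tk0 t x s : 0 <= env_kernel T w t x s by rewrite mulr_ge0// prob_vector_ge0.
have pf_ge t x : a ^+ n <= partfun T w n t x.
  rewrite /partfun; elim: n t x => [|n ih] t x //=.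
  have -> : a ^+ n.+1 = \sum_s w t%:Z x (st s) * a * a ^+ n.
    rewrite -!mulr_suml prob_vector_sum_st ?mul1r -?exprS// => z zU.
    exact: (gw _ _).1.
  apply: ler_sum => s _; apply: ler_pM => //.
  - by rewrite mulr_ge0// prob_vector_ge0.
  - exact: exprn_ge0.
  - by rewrite ler_wpM2l// prob_vector_ge0.
rewrite {2}/partfun iterK_comp -/(partfun T w n) -iterKZ.
rewrite -[leRHS]mul1r -(expr1n _ m); apply: le_iterK => // [t x s|x].
  by rewrite tk0 mul1r lexx.
by rewrite expr1n mulr1 exprn_ge0//= pf_ge.
Qed.

Lemma pow10_ratio (j : nat) :
  (j.+3 ^ 10)%N%:R <= (1 + (2 ^+ 10) / j.+2%:R) * (j.+2 ^ 10)%N%:R :> R.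
Proof.
have j2 : 0 < j.+2%:R :> R by [].
set x := j.+2%:R^-1 : R; have x0 : 0 <= x by rewrite invr_ge0.
have x1 : x <= 1 by rewrite invf_le1// ler1n.
(* The chord of the convex function [(1 + x) ^+ n] over [[0, 1]]. *)
have h n : (1 + x) ^+ n <= 1 + (2 ^+ n - 1) * x.
  elim: n => [|n ih]; first by rewrite !expr0 subrr mul0r addr0.
  have p1 : 1 <= 2 ^+ n :> R by rewrite exprn_ege1// ler1n.
  rewrite exprSr [2 ^+ n.+1]exprS.
  apply: (@le_trans _ _ ((1 + (2 ^+ n - 1) * x) * (1 + x))).
    by rewrite ler_wpM2r// addr_ge0.
  move: (2 ^+ n) p1 => p p1.
  have : 0 <= (p - 1) * (x * (1 - x)) by rewrite !mulr_ge0 ?subr_ge0.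
  by lra.
rewrite !natrX.
have -> : j.+3%:R = (1 + x) * j.+2%:R :> R.
  by rewrite mulrDl mul1r mulVf ?gt_eqF// natr1.
rewrite exprMn ler_wpM2r ?exprn_ge0//; apply: (le_trans (h 10)).
by rewrite lerD2l ler_wpM2r// gerBl.
Qed.

Lemma nat_above (x : R) : exists n : nat, x <= n%:R.
Proof. by exists (Num.truncn x).+1; rewrite ltW// truncnS_gt. Qed.

Lemma interleave (v : nat -> nat) J n : {homo v : i j / (i < j)%N >-> (i < j)%N} ->
  (v J <= n)%N -> exists2 j, (J <= j)%N & (v j <= n < v j.+1)%N.
Proof.
move=> vi; elim: n => [|n ih].
  rewrite leqn0 => /eqP vJ; exists J => //; rewrite vJ/=.
  by apply: (leq_ltn_trans _ (vi J J.+1 _)).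
rewrite leq_eqVlt => /predU1P[vJ|].
  by exists J => //; rewrite vJ leqnn/= -vJ; exact: vi.
rewrite ltnS => /ih[j Jj /andP[h1 h2]].
have [h|h] := ltnP n.+1 (v j.+1).
  by exists j => //; rewrite h leqW.
exists j.+1; first exact: leqW.
by rewrite h /= (leq_trans _ (vi j.+1 j.+2 _)).
Qed.

Lemma quenched_growth : (3 <= d)%N -> exists2 rho : R, 0 < rho &
  forall (th : 'rV[R]_d) (e : R), `|th| <= rho -> 0 < e ->
  {ae P, forall w, \forall n \near \oo,
    expR (- (e * n%:R)) <= partfun (tilt P th) w n 0 0 <= expR (e * n%:R)}.
Proof.
move=> d3; have [f [gamma [rho [gamma0 rho0 f01 h]]]] := lyapunov_tilt iid c_gt0 c_good d3.
exists rho => // th e thr e0.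
have [drift sm] := h th thr.
set T := tilt P th.
have T0 s : 0 <= T s := ltW (tilt_gt0 iid c_gt0 c_good th s).
have qT : \sum_s q P s * T s = 1 := sum_q_tilt iid c_gt0 c_good th.
have upper : {ae P, forall w, \forall n \near \oo, partfun T w n 0 0 <= expR (e * n%:R)}.
  have PF n : (P [set w | (n.+1%:R * n.+2%:R <= partfun T w n 0 0)%R] <=
      (1 / (n.+1%:R * n.+2%:R))%:E)%E.
    apply: (le_trans (mean_markov P (nnm_pf T0 n 0 0) _)); first by rewrite mulr_gt0.
    by rewrite mean_pf// mule1 mul1r.
  have mF n : measurable [set w | (n.+1%:R * n.+2%:R <= partfun T w n 0 0)%R].
    rewrite -[X in measurable X]setTI.
    by apply: measurable_fun_le => //; exact: (nnm_pf T0 n 0 0).1.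
  apply: filterS (borel_cantelli_telescope ler01 mF PF) => w.
  (* The cubic term of the exponential suffices: for [n >= 36 / e ^+ 3] and [n >= 1],
     [(e n)^3 / 6 >= 6 n^2 >= (n + 1)(n + 2)]. *)
  have [N NE] := nat_above (36 / e ^+ 3).
  have : \forall n \near \oo, n.+1%:R * n.+2%:R <= expR (e * n%:R) :> R.
    exists N.+1 => // n /= Nn.
    apply: (le_trans _ (expR_ge1Dxn 2 _)); last by rewrite mulr_ge0// ltW.
    have nN : N%:R <= n%:R :> R by rewrite ler_nat ltnW.
    have n1 : 1 <= n%:R :> R by rewrite ler1n (leq_trans _ Nn).
    have := le_trans NE nN; rewrite ler_pdivrMr ?exprn_gt0// => h36.
    rewrite (_ : (3`!)%:R = 6 :> R)//.
    rewrite -[n.+2%:R]natr1 -[n.+1%:R]natr1 exprMn; move: (n%:R) n1 h36 => x x1 h36.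
    have x2 : 0 <= x ^+ 2 by rewrite sqr_ge0.
    have : 36 * x ^+ 2 <= e ^+ 3 * x ^+ 3.
      by rewrite [x ^+ 3]exprS mulrA [e ^+ 3 * x]mulrC ler_wpM2r.
    nra.
  apply: filterS2 => n nn /negP; rewrite -ltNge => /ltW le.
  exact: (le_trans le).
have lower : {ae P, forall w, \forall n \near \oo, expR (- (e * n%:R)) <= partfun T w n 0 0}.
  (* Three losses share [e * n] equally: the averaged start, at most [la] per step over a fraction
     [1 / (p + 1)] of the time; the factor [1/2], which is at least [e^{-1}]; and the gap up to [n],
     at most [mu] per step. The choices of [p], [N] and [J'] control them in this order. *)
  set la := Num.max 1 (- ln c); set mu := 2 * rho.
  have [p p1] : exists p : nat, 3 * la / e <= p.+1%:R.
    have [p hp] := nat_above (3 * la / e).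
    by exists p; apply: (le_trans hp); rewrite ler_nat.
  set K := fun j => (j.+2 ^ 10)%N.
  pose F j := [set w : env R d | iterK (mean_kernel P T) (partfun T w (p * K j) (K j)) (K j) 0 0 < 2^-1].
  have mF j : measurable (F j).
    pose Z (w : env R d) := iterK (mean_kernel P T) (partfun T w (p * K j) (K j)) (K j) 0 0.
    have nZ : nonneg_mfun Z.
      apply: nnm_iterK => [t x s|x]; first by rewrite mulr_ge0// (q_ge0 iid).
      exact: nnm_pf.
    rewrite (_ : F j = ~` [set w | 2^-1 <= Z w]); last first.
      by apply/seteqP; split => w; rewrite /F /Z/= ltNge => /negP.
    apply: measurableC; rewrite -[X in measurable X]setTI.
    by apply: measurable_fun_le => //; exact: nZ.1.
  have PF j : (P (F j) <= (4 * (1 + gamma^-1) / (j.+1%:R * j.+2%:R))%:E)%E.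
    apply: (le_trans (averaged_start_lower iid T0 qT f01 sm _ _)).
    by rewrite lee_fin -mulrA ler_pM2l//; exact: (decay_pow iid T0 qT gamma0 f01 drift).
  have C0 : 0 <= 4 * (1 + gamma^-1) by rewrite mulr_ge0// addr_ge0// invr_ge0 ltW.
  apply: filterS2 c_good (borel_cantelli_telescope C0 mF PF) => w gw [J _ Jw].
  have [J' J'E] : exists J' : nat, mu * 2 ^+ 10 * 3 / e <= J'.+2%:R.
    have [J' hJ] := nat_above (mu * 2 ^+ 10 * 3 / e).
    by exists J'; apply: (le_trans hJ); rewrite ler_nat leqW.
  have [N NE] : exists N : nat, 3 / e <= N%:R by exact: nat_above.
  exists (maxn N (p.+1 * K (maxn J J')))%N => // n /=; rewrite geq_max => /andP[Nn Kn].
  have Khomo : {homo (fun j => p.+1 * K j)%N : i j / (i < j)%N >-> (i < j)%N}.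
    by move=> i j ij; rewrite ltn_pmul2l// ltn_exp2r.
  have [j + /andP[jn nj]] := @interleave (fun j => p.+1 * K j)%N (maxn J J') n Khomo Kn.
  rewrite geq_max => /andP[Jj J'j].
  have Zj : 2^-1 <= iterK (mean_kernel P T) (partfun T w (p * K j) (K j)) (K j) 0 0.
    by rewrite leNgt; apply/negP; exact: Jw.
  have b1 := pf_ge_averaged (K j) (p * K j) T0 gw.
  rewrite -mulSn in b1.
  have Tb s : expR (- mu) <= T s.
    by have /andP[] := tilt_bounds iid c_gt0 c_good s thr.
  have b2 := pf_ge_pow (p.+1 * K j) (n - p.+1 * K j) (expR_ge0 _) Tb gw.
  rewrite subnKC// in b2; apply: le_trans b2.
  apply: (@le_trans _ _ (expR (- mu) ^+ (n - p.+1 * K j) * (c ^+ K j * 2^-1))); last first.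
    rewrite ler_pM2l ?exprn_gt0 ?expR_gt0//; apply: le_trans b1.
    by rewrite ler_pM2l ?exprn_gt0.
  have cla : expR (- la) <= c.
    by rewrite -[leRHS]lnK ?posrE// ler_expR lerNl le_max lexx orbT.
  have e2 : expR (- 1) <= 2^-1 :> R.
    by rewrite expRN lef_pV2 ?posrE ?expR_gt0//; have := expR_ge1Dx (1 : R); lra.
  apply: (@le_trans _ _ (expR (- mu) ^+ (n - p.+1 * K j) * (expR (- la) ^+ K j * expR (- 1)))); last first.
    rewrite ler_pM2l ?exprn_gt0 ?expR_gt0//; apply: (ler_pM (exprn_ge0 _ (expR_ge0 _)) (expR_ge0 _) _ e2).
    by rewrite lerXn2r ?nnegrE ?expR_ge0// ltW.
  rewrite -!expRM_natl -!expRD ler_expR.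
  have ratio := pow10_ratio j; rewrite -/(K j) -/(K j.+1) in ratio.
  have mu0 : 0 < mu by rewrite mulr_gt0.
  have h1 : 3 <= e * n%:R.
    by rewrite mulrC -ler_pdivrMr// (le_trans NE)// ler_nat.
  have jn' : p.+1%:R * (K j)%:R <= n%:R :> R by rewrite -natrM ler_nat.
  have nj' : n%:R <= p.+1%:R * (K j.+1)%:R :> R by rewrite -natrM ler_nat ltnW.
  have h2 : 3 * la * (K j)%:R <= e * n%:R.
    move: p1; rewrite ler_pdivrMr// => p1.
    apply: (@le_trans _ _ (p.+1%:R * e * (K j)%:R)); first by rewrite ler_wpM2r.
    by rewrite (mulrC _ e) -mulrA ler_pM2l.
  have h3 : 3 * mu * (n%:R - p.+1%:R * (K j)%:R) <= e * n%:R.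
    have j2 : 0 < j.+2%:R :> R by [].
    have J'j2 : mu * 2 ^+ 10 * 3 / e <= j.+2%:R by rewrite (le_trans J'E)// ler_nat.
    move: J'j2; rewrite ler_pdivrMr// => J'j2.
    apply: (@le_trans _ _ (3 * mu * (2 ^+ 10 / j.+2%:R * n%:R))).
      rewrite ler_pM2l ?mulr_gt0//.
      move: (2 ^+ 10 / j.+2%:R) (divr_ge0 (exprn_ge0 10 (ler0n R 2)) (ltW j2)) ratio => r r0 ratio.
      have : p.+1%:R * (K j.+1)%:R <= p.+1%:R * ((1 + r) * (K j)%:R) by rewrite ler_wpM2l.
      have : r * (p.+1%:R * (K j)%:R) <= r * n%:R by rewrite ler_wpM2l.
      move: (p.+1%:R * (K j.+1)%:R) nj' => X nj' h4 h5.
      apply: (le_trans _ h4); rewrite lerBlDr; apply: (le_trans nj'); apply: (le_trans h5).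
      by rewrite le_eqVlt; apply/orP; left; apply/eqP; ring.
    rewrite mulrA ler_wpM2r// mulrA ler_pdivrMr// (mulrC e).
    by apply: le_trans J'j2; rewrite le_eqVlt; apply/orP; left; apply/eqP; ring.
  rewrite natrB// natrM.
  rewrite -subr_ge0 in h1; rewrite -subr_ge0 in h2; rewrite -subr_ge0 in h3.
  rewrite -subr_ge0 -(@pmulr_rge0 _ 3)//.
  set l1 := _ - 3 in h1; set l2 := _ - _ in h2; set l3 := _ - _ in h3.
  have E X : X = l1 + l2 + l3 -> 0 <= X.
    by move=> ->; exact: addr_ge0 (addr_ge0 h1 h2) h3.
  by apply: E; rewrite /l1 /l2 /l3; ring.
by apply: filterS2 upper lower => w; apply: filterS2 => n -> ->.
Qed.

End quenched_growth.

(** * The quenched law as a sum over paths *)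

Section quenched_walk.
Variables (R : realType) (d : nat) (w : env R d) (Q : probability (walk d) R).
Hypothesis w_sum : forall n x, \sum_s w n x (st s) = 1.
Hypothesis lawQ : quenched_law w Q.
Implicit Types (x : walk d) (A : set (site d)).

Let wk (t : nat) y s : R := w t%:Z y (st s).

Definition history n x : set (walk d) := [set X | forall k, (k <= n)%N -> X k = x k].

Lemma measurable_at n A : measurable [set X : walk d | A (X n)].
Proof.
rewrite (_ : [set _ | _] = \bigcup_(y : site d) (if pselect (A y) then [set X : walk d | X n = y] else set0)).
  apply: countable_bigcupT_measurable; first exact: countableP.
  move=> y; case: (pselect (A y)) => _ /=; last exact: measurable0.
  by apply: sub_sigma_algebra; exists n, y.
apply/seteqP; split => [X /= AX|X [y _]].
  by exists (X n) => //; case: pselect.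
by case: (pselect (A y)) => //= Ay Xn; rewrite /= Xn.
Qed.

Lemma measurable_history n x : measurable (history n x).
Proof.
rewrite (_ : history n x = \bigcap_(k in [set k | (k <= n)%N]) [set X | [set x k] (X k)]).
  by apply: bigcap_measurableType => k _; exact: measurable_at.
by apply/seteqP; split => X h k /h.
Qed.

Let extend t x (s : step d) : walk d := fun k => if (k <= t)%N then x k else x t + st s.

Let history_extend t x s : history t (extend t x s) = history t x.
Proof.
by apply/seteqP; split => X h k kt; rewrite h// /extend kt.
Qed.

Let Q_extend t x s : Q (history t.+1 (extend t x s)) = (Q (history t x) * (wk t (x t) s)%:E)%E.
Proof.
rewrite /history lawQ.2 -/(history t _) history_extend /extend ltnn leqnn.
by rewrite addrC addKr.
Qed.

Let extendS t x s : extend t x s t.+1 = x t + st s.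
Proof. by rewrite /extend ltnn. Qed.

(** Induction on [n], splitting over the next step. The measure [Q] lives on all sequences of sites,
    but by [w_sum] the nearest-neighbour extensions of a history carry its whole mass, and the rest
    is a null set. *)
Lemma history_after n t x A :
  Q (history t x `&` [set X | A (X (t + n)%N)]) =
  (Q (history t x) * (iterK wk \1_A n t (x t))%:E)%E.
Proof.
elim: n t x => [|n ih] t x.
  rewrite addn0 /= indicE; case: (boolP (x t \in A)) => [|/negP xA].
    rewrite inE => xA; rewrite mule1; congr (Q _).
    by apply/seteqP; split => [X []//|X h]; split => //=; rewrite h.
  rewrite mule0 (_ : _ `&` _ = set0) ?measure0//.
  by apply/seteqP; split => // X [h /=]; rewrite h// => xA'; apply: xA; rewrite inE.
set E := [set X : walk d | A (X (t + n.+1)%N)].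
have mE : measurable E by exact: measurable_at.
pose C s := history t.+1 (extend t x s).
have mC s : measurable (C s) by exact: measurable_history.
have mH : measurable (history t x) by exact: measurable_history.
have tC : trivIset setT C.
  move=> s s' _ _ [X [h h']]; apply: (@st_inj d); apply: (addrI (x t)).
  by rewrite -!extendS -h// -h'.
have CH : \bigcup_s C s `<=` history t x.
  move=> X [s _ h] k kt; rewrite (h k (leqW kt)) /extend kt//.
have mU : measurable (\bigcup_s C s).
  by apply: fin_bigcup_measurable => //; exact: finite_finset.
have sumE (F : step d -> \bar R) : (\sum_(s \in setT) F s = \sum_s F s)%E.
  rewrite [RHS]fsbig_seq ?index_enum_uniq//.
  by apply: eq_fsbigl; apply/seteqP; split => y //= _; rewrite mem_index_enum.
have QU : Q (\bigcup_s C s) = Q (history t x).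
  rewrite measure_fin_bigcup//; last exact: finite_finset.
  rewrite sumE (eq_bigr (fun s => (Q (history t x) * (wk t (x t) s)%:E)%E)) => [|s _]; last exact: Q_extend.
  rewrite -ge0_sume_distrr => [|s _]; last by rewrite lee_fin prob_vector_ge0.
  by rewrite sumEFin w_sum mule1.
have Q0 : Q (history t x `\` \bigcup_s C s) = 0%E.
  rewrite measureD// ?(le_lt_trans (probability_le1 _ _)) ?ltry//.
  rewrite setIidr//; change (Q (history t x) - Q (\bigcup_s C s) = 0)%E.
  by rewrite QU subee// fin_num_measure.
have -> : Q (history t x `&` E) = Q ((\bigcup_s C s) `&` E).
  rewrite (measureDI Q (measurableI _ _ mH mE) mU).
  rewrite -[RHS]add0e; congr (_ + _)%E; last first.
    by rewrite setIAC (setIidr CH).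
  apply/eqP; rewrite eq_le measure_ge0 andbT -Q0; apply: le_measure; rewrite ?inE.
  - by apply: measurableD => //; exact: measurableI.
  - exact: measurableD.
  - by move=> X [[h _] n']; split.
rewrite setI_bigcupl measure_fin_bigcup; last first.
- by move=> s _; exact: measurableI.
- by apply: trivIset_setIr.
- exact: finite_finset.
rewrite sumE /= -sumEFin ge0_sume_distrr => [|s _]; last first.
  rewrite lee_fin mulr_ge0 ?prob_vector_ge0//; apply: iterK_ge0 => // *.
  exact: prob_vector_ge0.
apply: eq_bigr => s _; rewrite /E -addSnnS ih Q_extend extendS -muleA -EFinM.
by [].
Qed.

Lemma quenched_lawE n A : Q [set X | A (X n)] = (iterK wk \1_A n 0 0)%:E.
Proof.
pose x0 : walk d := fun=> 0.
have mH := measurable_history 0 x0.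
have H1 : Q (history 0 x0) = 1%E.
  rewrite -lawQ.1; congr (Q _).
  apply/seteqP; split => X /= h; first by rewrite h.
  by move=> k; rewrite leqn0 => /eqP ->.
have := history_after n 0 x0 A; rewrite H1 mul1e add0n => <-.
rewrite setIC [LHS](measureDI Q (measurable_at n A) mH).
rewrite -[RHS]add0e; congr (_ + _)%E.
apply/eqP; rewrite eq_le measure_ge0 andbT.
apply: (@le_trans _ _ (Q (~` history 0 x0))).
  apply: le_measure; rewrite ?inE.
  - by apply: measurableD => //; exact: measurable_at.
  - exact: measurableC.
  - by move=> X [].
by rewrite probability_setC// H1 subee.
Qed.

End quenched_walk.

(** * The saddle point near the mean velocity *)

Section scalar_inequalities.
Variable R : realType.
Implicit Types u : R.

Lemma expR_ge_quad u : -1 <= u -> 1 + u + u ^+ 2 / 4 <= expR u.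
Proof.
move=> u1; have -> : u = u / 2 + u / 2 by field.
rewrite expRD -expr2 (_ : _ + _ + _ = (1 + u / 2) ^+ 2); last by field.
have h := expR_ge1Dx (u / 2).
by rewrite ler_pXn2r ?nnegrE ?expR_ge0//; lra.
Qed.

Lemma expR_le_quad u : `|u| <= 2^-1 -> expR u <= 1 + u + 2 * u ^+ 2.
Proof.
rewrite ler_norml => /andP[u1 u2].
have h : 1 - u <= expR (- u) by have := expR_ge1Dx (- u); lra.
have u3 : 0 < 1 - u by lra.
have : expR u <= (1 - u)^-1.
  by rewrite -[u in expR u]opprK expRN lef_pV2 ?posrE ?expR_gt0.
move=> /le_trans; apply; rewrite -[leLHS]mul1r ler_pdivrMr//.
have : 0 <= u ^+ 2 * (1 - 2 * u) by rewrite mulr_ge0 ?sqr_ge0//; lra.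
by rewrite exprS expr1; lra.
Qed.

(** Meets finitely many smallness conditions with one explicit [t], the inverse of
    [1 + \sum_i a i / b i]. *)
Lemma small_scalar (I : finType) (a b : I -> R) :
  (forall i, 0 <= a i) -> (forall i, 0 < b i) ->
  exists2 t, 0 < t & forall i, t * a i < b i.
Proof.
move=> a0 b0; pose S := \sum_i a i / b i.
have S0 : 0 <= S by apply: sumr_ge0 => i _; rewrite divr_ge0// ltW.
exists (1 + S)^-1 => [|i]; first by rewrite invr_gt0 ltr_pwDl.
rewrite mulrC ltr_pdivrMr ?ltr_pwDl//.
have : a i / b i <= S.
  by rewrite /S (bigD1 i)//= lerDl sumr_ge0// => j _; rewrite divr_ge0// ltW.
rewrite ler_pdivrMr// mulrC => h.
by rewrite mulrDr mulr1 ltr_pwDl.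
Qed.

End scalar_inequalities.

Lemma continuous_sum (T : topologicalType) (R : realType) (I : Type) (r : seq I)
    (F : I -> T -> R) :
  (forall i, continuous (F i)) -> continuous (fun x => \sum_(i <- r) F i x).
Proof.
move=> cF x; elim: r => [|i r ih].
  rewrite (_ : (fun _ => _) = cst 0); first exact: cvg_cst.
  by apply/funext => y; rewrite big_nil.
rewrite (_ : (fun _ => _) = fun y => F i y + \sum_(j <- r) F j y).
  exact: (cvgD (cF i x) ih).
by apply/funext => y; rewrite big_cons.
Qed.

Lemma continuous_dot (R : realType) d (u : 'rV[R]_d) : continuous (fun x => dot x u).
Proof.
apply: continuous_sum => i x.
exact: (cvgM (@coord_continuous _ _ _ 0 i x) (cvg_cst _)).
Qed.

Section enorm.
Variables (R : realType) (d : nat).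
Implicit Types x y : 'rV[R]_d.

Lemma dot_ge0 x : 0 <= dot x x.
Proof. by apply: sumr_ge0 => i _; exact: sqr_ge0. Qed.

Lemma coord_le_enorm x i : `|x 0 i| <= enorm x.
Proof.
rewrite /enorm -sqrtr_sqr ler_sqrt ?dot_ge0// /dot (bigD1 i)//= expr2 lerDl.
by apply: sumr_ge0 => j _; exact: sqr_ge0.
Qed.

Lemma coord_le_norm x i : `|x 0 i| <= `|x|.
Proof. rewrite [leRHS]mx_normrE; exact: (le_bigmax _ (fun ij => `|x ij.1 ij.2|) (0, i)). Qed.

Lemma norm_le_enorm x : `|x| <= enorm x.
Proof.
rewrite [leLHS]mx_normrE; apply: bigmax_le => [|[i j] _]; first exact: sqrtr_ge0.
by rewrite ord1; exact: coord_le_enorm.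
Qed.

Lemma norm_dot_le x y : `|dot x y| <= d%:R * (`|x| * `|y|).
Proof.
rewrite (le_trans (ler_norm_sum _ _ _))//.
rewrite (@le_trans _ _ (\sum_(i < d) `|x| * `|y|))//.
  by apply: ler_sum => i _; rewrite normrM ler_pM// coord_le_norm.
by rewrite sumr_const card_ord mulr_natl.
Qed.

Lemma continuous_enorm : continuous (@enorm R d).
Proof.
move=> x; apply: (@continuous_comp _ _ _ (fun x => dot x x) Num.sqrt); last first.
  exact: sqrt_continuous.
apply: continuous_sum => i y.
exact: (cvgM (@coord_continuous _ _ _ 0 i y) (@coord_continuous _ _ _ 0 i y)).
Qed.

End enorm.

Section saddle.
Variables (R : realType) (d : nat) (q : step d -> R) (c : R).
Hypothesis c_gt0 : 0 < c.
Hypothesis q_ge : forall s, c <= q s.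
Hypothesis q1 : \sum_s q s = 1.
Implicit Types (th xi v : 'rV[R]_d).

Let e s : 'rV[R]_d := embed R (st s).
Let q_ge0 s : 0 <= q s. Proof. exact: le_trans (ltW c_gt0) (q_ge s). Qed.
Let q_gt0 s : 0 < q s. Proof. exact: lt_le_trans c_gt0 (q_ge s). Qed.

Definition drift_velocity : 'rV[R]_d := \sum_s q s *: e s.
Local Notation xi0 := drift_velocity.

(** This is [phi(th) e^{-<th, xi>}], whose infimum over [th] is [e^{-I_a(xi)}]; minimizing it avoids
    the logarithm. *)
Definition recentred_mgf xi th : R := \sum_s q s * expR (dot th (e s - xi)).
Local Notation J := recentred_mgf.

Lemma recentred_mgf0 xi : J xi 0 = 1.
Proof. by rewrite /J -[RHS]q1; apply: eq_bigr => s _; rewrite dot0l expR0 mulr1. Qed.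

Lemma recentred_mgf_continuous xi : continuous (J xi).
Proof.
apply: continuous_sum => s th.
have ce : {for th, continuous (fun th => expR (dot th (e s - xi)))}.
  apply: (@continuous_comp _ _ _ (fun th => dot th (e s - xi)) expR).
    exact: continuous_dot.
  exact: continuous_expR.
exact: (cvgM (cvg_cst _) ce).
Qed.

Lemma recentred_mgf_gt0 xi th : (0 < d)%N -> 0 < J xi th.
Proof.
move=> d0; pose s0 : step d := (Ordinal d0, false).
rewrite /J (bigD1 s0)//= ltr_pwDl ?mulr_gt0 ?expR_gt0//.
by apply: sumr_ge0 => s _; rewrite mulr_ge0 ?expR_ge0.
Qed.

Lemma norm_dot_xi0 th : `|dot th xi0| <= `|th|.
Proof.
rewrite dot_sumr (le_trans (ler_norm_sum _ _ _))//.
rewrite -[leRHS]mul1r -q1 mulr_suml; apply: ler_sum => s _.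
by rewrite dotZr normrM ger0_norm// ler_wpM2l// norm_dot_st.
Qed.

Lemma sum_dot_xi0 th : \sum_s q s * dot th (e s - xi0) = 0.
Proof.
under eq_bigr do rewrite dotBr mulrBr.
rewrite sumrB -mulr_suml q1 mul1r dot_sumr.
by apply/eqP; rewrite subr_eq0; apply/eqP; apply: eq_bigr => s _; rewrite dotZr.
Qed.

Lemma recentred_mgf_xi0_ge th : `|th| <= 2^-1 -> 1 + c / 2 * `|th| ^+ 2 <= J xi0 th.
Proof.
move=> th1; have [->|th0] := eqVneq th 0.
  by rewrite normr0 expr0n/= mulr0 addr0 recentred_mgf0.
have small s : `|dot th (e s - xi0)| <= 1.
  rewrite dotBr (le_trans (ler_normB _ _))//.
  by have := norm_dot_xi0 th; have := norm_dot_st th s; rewrite -/(e s); lra.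
have h : \sum_s q s * (1 + dot th (e s - xi0) + dot th (e s - xi0) ^+ 2 / 4) <= J xi0 th.
  apply: ler_sum => s _; rewrite ler_wpM2l// expR_ge_quad//.
  by have := small s; rewrite ler_norml => /andP[].
apply: le_trans h.
have -> : \sum_s q s * (1 + dot th (e s - xi0) + dot th (e s - xi0) ^+ 2 / 4) =
    1 + (\sum_s q s * dot th (e s - xi0) ^+ 2) / 4.
  transitivity (\sum_s q s + \sum_s q s * dot th (e s - xi0) +
                (\sum_s q s * dot th (e s - xi0) ^+ 2) / 4).
    by rewrite mulr_suml -!big_split/=; apply: eq_bigr => s _; ring.
  by rewrite sum_dot_xi0 q1 addr0.
rewrite lerD2l.
(* The two opposite steps along a maximal coordinate already give the quadratic term:
   [(x - m)^2 + (- x - m)^2 >= 2 x^2]. *)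
have [i thi] : exists i, `|th| = `|th 0 i|.
  have /mx_norm_neq0[[k i] thE] : mx_norm th != 0 by rewrite -[mx_norm th]/(`|th|) normr_eq0.
  by exists i; rewrite -[`|th|]/(mx_norm th) thE ord1.
pose s1 : step d := (i, false); pose s2 : step d := (i, true).
have s12 : s2 != s1 by apply/eqP => -[].
rewrite ler_pdivlMr// (bigD1 s1)//= (bigD1 s2)//=.
set rest := \sum_(_ | _) _; have rest0 : 0 <= rest.
  by apply: sumr_ge0 => s _; rewrite mulr_ge0 ?sqr_ge0.
rewrite !dotBr !dot_st/= expr0 expr1 mul1r mulN1r thi real_normK ?num_real//.
move: (th 0 i) (dot th xi0) => x m.
have a1 : c * (x - m) ^+ 2 <= q s1 * (x - m) ^+ 2 by rewrite ler_wpM2r ?sqr_ge0.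
have a2 : c * (- x - m) ^+ 2 <= q s2 * (- x - m) ^+ 2 by rewrite ler_wpM2r ?sqr_ge0.
have m2 : 0 <= c * m ^+ 2 by rewrite mulr_ge0 ?sqr_ge0// ltW.
have : c * (x - m) ^+ 2 + c * (- x - m) ^+ 2 = 2 * (c * x ^+ 2) + 2 * (c * m ^+ 2) by ring.
lra.
Qed.

Lemma recentred_mgf_shift xi th : J xi th = J xi0 th * expR (- dot th (xi - xi0)).
Proof.
rewrite /J mulr_suml; apply: eq_bigr => s _; rewrite -mulrA -expRD -dotNr -dotDr.
by congr (_ * expR (dot _ _)); rewrite opprB addrA subrK.
Qed.

(** [J xi] exceeds [J xi 0 = 1] on the sphere of radius [r], so its minimum over the ball is
    interior and critical. Criticality makes it global, by [e^u >= 1 + u], and leaves only a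
    second-order increase in any direction [v], which is below [t * delta] for small [t]. *)
Lemma saddle (r : R) : 0 < r -> r <= 2^-1 -> (0 < d)%N ->
  exists2 eta : R, 0 < eta & forall xi, enorm (xi - xi0) < eta ->
  exists th, [/\ `|th| < r, forall th', J xi th <= J xi th' &
    forall v delta, 0 < delta -> exists t,
      [/\ 0 < t, `|th + t *: v| < r & J xi (th + t *: v) < J xi th * expR (t * delta)]].
Proof.
move=> r0 r1 d0.
have c1 : c <= 1.
  apply: (le_trans (q_ge (Ordinal d0, false))).
  by rewrite -q1 (bigD1 (Ordinal d0, false))//= lerDl sumr_ge0.
have dR : 0 < d%:R :> R by rewrite ltr0n.
(* On the sphere this bounds [<th, xi - xi0>] by [c r^2 / 8], which the gain [c r^2 / 2] of
   [recentred_mgf_xi0_ge] outweighs. *)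
exists (c * r / (8 * d%:R)); first by rewrite divr_gt0// !mulr_gt0.
move=> xi xi_near.
pose B : set 'rV[R]_d := [set th | `|th| <= r].
have B0 : B !=set0 by exists 0; rewrite /B/= normr0 ltW.
have cB : compact B.
  apply: bounded_closed_compact.
    exists r; split; first exact: num_real.
    by move=> x rx y; rewrite /B/= => /le_trans; apply; exact: ltW.
  apply: (@closed_comp _ _ (fun th : 'rV[R]_d => `|th|) [set x | x <= r]).
    by move=> th _; exact: norm_continuous.
  exact: closed_le.
have [th] := EVT_min_rV B0 cB (continuous_subspaceT (@recentred_mgf_continuous xi)).
rewrite inE => thB th_min.
have thr : `|th| < r.
  rewrite lt_neqAle thB andbT; apply/eqP => thE.
  have : J xi th <= 1.
    by rewrite -(recentred_mgf0 xi); apply: th_min; rewrite inE /B/= normr0 ltW.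
  apply/negP; rewrite -ltNge recentred_mgf_shift.
  have h1 : 1 + c / 2 * r ^+ 2 <= J xi0 th.
    by rewrite -thE; apply: recentred_mgf_xi0_ge; rewrite thE.
  have h2 : dot th (xi - xi0) <= c / 8 * r ^+ 2.
    apply: (le_trans (ler_norm _)); apply: (le_trans (norm_dot_le _ _)).
    rewrite thE; apply: (@le_trans _ _ (d%:R * (r * (c * r / (8 * d%:R))))).
      rewrite ler_pM2l// ler_pM2l// ltW// (le_lt_trans _ xi_near)//.
      exact: norm_le_enorm.
    by rewrite le_eqVlt; apply/orP; left; apply/eqP; field; rewrite gt_eqF.
  have h3 := expR_ge1Dx (- dot th (xi - xi0)).
  have cr : 0 < c * r ^+ 2 by rewrite mulr_gt0 ?exprn_gt0.
  have r2 : r ^+ 2 <= 2^-1 by nra.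
  have cr1 : c * r ^+ 2 <= 2^-1 by nra.
  apply: (@lt_le_trans _ _ ((1 + c / 2 * r ^+ 2) * (1 - c / 8 * r ^+ 2))).
    have -> : c / 2 * r ^+ 2 = (c * r ^+ 2) / 2 by field.
    have -> : c / 8 * r ^+ 2 = (c * r ^+ 2) / 8 by field.
    by move: (c * r ^+ 2) cr cr1 => a a0 a1; nra.
  apply: ler_pM => //; [nra|nra|lra].
pose p s := q s * expR (dot th (e s - xi)).
have pJ : J xi th = \sum_s p s by [].
have p0 s : 0 <= p s by rewrite mulr_ge0 ?expR_ge0.
have JD v : J xi (th + v) = \sum_s p s * expR (dot v (e s - xi)).
  by apply: eq_bigr => s _; rewrite dotDl expRD mulrA.
pose m v := \sum_s p s * dot v (e s - xi).
pose V v := 2 * \sum_s p s * dot v (e s - xi) ^+ 2.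
have V0 v : 0 <= V v.
  by rewrite mulr_ge0// sumr_ge0// => s _; rewrite mulr_ge0 ?sqr_ge0.
have upper v : (forall s, `|dot v (e s - xi)| <= 2^-1) ->
    J xi (th + v) <= J xi th + m v + V v.
  move=> vs; rewrite JD pJ /m /V mulr_sumr -!big_split/=; apply: ler_sum => s _.
  apply: (le_trans (ler_wpM2l (p0 s) (expR_le_quad (vs s)))).
  by rewrite le_eqVlt; apply/orP; left; apply/eqP; ring.
have small v (a b : R) : 0 <= a -> 0 < b -> exists t,
    [/\ 0 < t, `|th + t *: v| < r, forall s, `|dot (t *: v) (e s - xi)| <= 2^-1 &
        t * a < b].
  move=> a0 b0.
  (* The conditions on [t] are indexed by one finite type: [None] for [t * a < b], [Some None] for
     staying in the ball, and one condition per step for the quadratic bound on the exponential. *)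
  pose f (o : option (option (step d))) : R := match o with
    | None => a | Some None => `|v| | Some (Some s) => `|dot v (e s - xi)| end.
  pose g (o : option (option (step d))) : R := match o with
    | None => b | Some None => r - `|th| | Some (Some s) => 2^-1 end.
  have [||t t0 fg] := @small_scalar R _ f g.
  - by case=> [[s|]|]//=.
  - by case=> [[s|]|]//=; rewrite ?subr_gt0 ?invr_gt0.
  exists t; split => //.
  - rewrite (le_lt_trans (ler_normD _ _))// normrZ (gtr0_norm t0).
    by have := fg (Some None); rewrite /=; lra.
  - move=> s; rewrite dotZl normrM (gtr0_norm t0).
    by rewrite ltW//; exact: (fg (Some (Some s))).
  - exact: (fg None).
have mZ t v : m (t *: v) = t * m v.
  by rewrite /m mulr_sumr; apply: eq_bigr => s _; rewrite dotZl; ring.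
have VZ t v : V (t *: v) = t ^+ 2 * V v.
  by rewrite /V mulrCA; congr (2 * _); rewrite mulr_sumr; apply: eq_bigr => s _;
    rewrite dotZl; ring.
(* [m v] is the derivative of [J xi] at [th] along [v]. If it were negative, a short move would go
   below the minimum inside the ball; applying this to [- v] as well gives [m v = 0]. *)
have m_ge0 v : 0 <= m v.
  rewrite leNgt; apply/negP => mv.
  have [t [t0 tr ts tV]] := small v (V v) (- m v) (V0 v) (ltac:(lra)).
  have := upper _ ts; rewrite mZ VZ; apply/negP; rewrite -ltNge.
  have := th_min (th + t *: v); rewrite inE /B/= => /(_ (ltW tr)).
  have : 0 < t * (- m v - t * V v) by rewrite mulr_gt0//; lra.
  lra.
have m0 v : m v = 0.
  apply/eqP; rewrite eq_le m_ge0 andbT.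
  have := m_ge0 (- v); rewrite -scaleN1r mZ; lra.
have J0 : 0 < J xi th by exact: recentred_mgf_gt0.
exists th; split => // [th'|v delta delta0].
  have -> : th' = th + (th' - th) by rewrite addrC subrK.
  move: (th' - th) => v; rewrite JD.
  apply: (@le_trans _ _ (J xi th + m v)); first by rewrite m0 addr0.
  rewrite pJ /m -big_split/=.
  apply: ler_sum => s _; rewrite -[X in X + _]mulr1 -mulrDr ler_wpM2l//.
  exact: expR_ge1Dx.
have [t [t0 tr ts tV]] := small v (V v) (delta * J xi th) (V0 v) (mulr_gt0 delta0 J0).
exists t; split => //.
apply: (le_lt_trans (upper _ ts)); rewrite m0 addr0 VZ.
apply: (@lt_le_trans _ _ (J xi th * (1 + t * delta))); last first.
  by rewrite ler_pM2l// expR_ge1Dx.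
rewrite mulrDr mulr1 ltrD2l expr2 -mulrA.
rewrite (_ : J xi th * (t * delta) = t * (delta * J xi th)); last by ring.
by rewrite ltr_pM2l.
Qed.

End saddle.

(** * One null set for all small tilts *)

Lemma rat_approx (R : realType) d (th : 'rV[R]_d) (dl : R) : 0 < dl ->
  exists v : 'rV[rat]_d, `|th - map_mx ratr v| <= dl.
Proof.
move=> dl0.
have h i : {q : rat | `|th 0 i - ratr q| <= dl}.
  apply: cid; have [q] := @rat_in_itvoo R (th 0 i - dl) (th 0 i + dl) (ltac:(lra)).
  rewrite in_itv/= => /andP[h1 h2]; exists q; rewrite ler_norml; lra.
exists (\row_i sval (h i)).
rewrite [leLHS]mx_normrE; apply: bigmax_le => [|[i j] _]; first exact: ltW.
by rewrite ord1 !mxE; exact: (svalP (h j)).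
Qed.

Section all_tilts.
Variables (R : realType) (d : nat) (P : probability (env R d) R).
Hypothesis iid : iid_env P.
Variable c : R.
Hypothesis c_gt0 : 0 < c.
Hypothesis c_good : {ae P, forall w, good c w}.

Lemma tilt_le (th th' : 'rV[R]_d) (dl : R) s : `|th - th'| <= dl ->
  tilt P th s <= expR (2 * dl) * tilt P th' s.
Proof.
move=> thd.
have e_le (a b : 'rV[R]_d) s' : `|a - b| <= dl ->
    expR (dot a (embed R (st s'))) <= expR dl * expR (dot b (embed R (st s'))).
  move=> ab; rewrite -expRD ler_expR.
  have := le_trans (norm_dot_st (a - b) s') ab; rewrite dotBl ler_norml; lra.
have m_le : mgf P th' <= expR dl * mgf P th.
  rewrite !mgfE mulr_sumr; apply: ler_sum => s' _.
  rewrite mulrCA ler_wpM2l ?(q_ge0 iid)//.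
  by apply: e_le; rewrite distrC.
have m0 := mgf_gt0 iid c_gt0 c_good.
rewrite /tilt ler_pdivrMr// (le_trans (e_le _ _ s thd))//.
rewrite (_ : 2 * dl = dl + dl) ?expRD; last by ring.
set E := expR (dot th' _); have E0 : 0 < expR dl * E by rewrite mulr_gt0 ?expR_gt0.
have -> : expR dl * expR dl * (E / mgf P th') * mgf P th =
    (expR dl * E) * (expR dl * mgf P th / mgf P th') by ring.
by rewrite ler_pMr// ler_pdivlMr// mul1r.
Qed.

Lemma pf_tilt_le (th th' : 'rV[R]_d) (dl : R) w n : `|th - th'| <= dl ->
  partfun (tilt P th) w n 0 0 <= expR (2 * dl * n%:R) * partfun (tilt P th') w n 0 0.
Proof.
move=> thd; rewrite expRM_natr; apply: le_iterK => [|t x s|x].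
- exact: expR_ge0.
- rewrite /env_kernel mulr_ge0 ?prob_vector_ge0//=; last first.
    by rewrite ltW// (tilt_gt0 iid c_gt0 c_good).
  by rewrite [leRHS]mulrCA ler_wpM2l ?prob_vector_ge0// tilt_le.
- by rewrite ler01 lexx.
Qed.

Definition growth (r : R) (w : env R d) : Prop :=
  forall (th : 'rV[R]_d) (e : R), `|th| < r -> 0 < e ->
  \forall n \near \oo,
    expR (- (e * n%:R)) <= partfun (tilt P th) w n 0 0 <= expR (e * n%:R).

Lemma growth_ae : (3 <= d)%N -> exists2 r : R, 0 < r & {ae P, forall w, growth r w}.
Proof.
move=> d3; have [rho rho0 h] := quenched_growth iid c_gt0 c_good d3.
exists rho => //.
have : {ae P, forall w, forall i : 'rV[rat]_d * nat,
    `|map_mx ratr i.1 : 'rV[R]_d| <= rho ->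
    \forall n \near \oo,
      expR (- (i.2.+1%:R^-1 * n%:R)) <= partfun (tilt P (map_mx ratr i.1)) w n 0 0 <=
      expR (i.2.+1%:R^-1 * n%:R)}.
  apply: ae_forall_count => -[v N] /=.
  have [vr|vr] := boolP (`|map_mx ratr v : 'rV[R]_d| <= rho); last exact: aeW.
  have := h (map_mx ratr v) (N.+1%:R^-1) vr; rewrite invr_gt0 ltr0n => /(_ isT).
  exact: filterS.
apply: filterS => w hw th e thr e0.
(* The first bound makes the change of tilt cost at most [e * n / 2] in the exponent. The second
   keeps the rational tilt within radius [rho]; it is positive because [growth] asks for a strict
   inequality. *)
have dl0 : 0 < Num.min (e / 4) (rho - `|th|).
  by rewrite lt_min subr_gt0 thr divr_gt0.
have [v vth] := rat_approx th dl0.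
set dl := Num.min _ _ in dl0 vth.
have [N NE] : exists N : nat, N.+1%:R^-1 <= e / 2 :> R.
  have [N NE] := nat_above (2 / e).
  exists N; rewrite -[leRHS]invrK lef_pV2 ?posrE ?invr_gt0 ?divr_gt0 ?ltr0n//.
  by rewrite invf_div (le_trans NE)// ler_nat.
have vr : `|map_mx ratr v : 'rV[R]_d| <= rho.
  rewrite -[map_mx _ _](subrK th) (le_trans (ler_normD _ _))// distrC.
  rewrite -lerBrDr (le_trans vth)// ge_min lexx orbT//.
have dle : dl <= e / 4 by rewrite ge_min lexx.
apply: filterS (hw (v, N) vr) => n /= /andP[h1 h2].
have n0 : 0 <= n%:R :> R by [].
have dln : 2 * dl * n%:R <= e / 2 * n%:R by rewrite ler_wpM2r//; lra.
have Nn : N.+1%:R^-1 * n%:R <= e / 2 * n%:R by rewrite ler_wpM2r.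
move: (N.+1%:R^-1 * n%:R) h1 h2 Nn => X h1 h2 Nn.
apply/andP; split.
  have := pf_tilt_le w n (_ : `|map_mx ratr v - th| <= dl).
  rewrite distrC => /(_ vth) h3.
  have := le_trans h1 h3; rewrite -ler_pdivrMl ?expR_gt0// -expRN -expRD.
  by move=> h4; apply: le_trans h4; rewrite ler_expR; lra.
apply: (le_trans (pf_tilt_le w n vth)).
apply: (@le_trans _ _ (expR (2 * dl * n%:R) * expR X)).
  by rewrite ler_pM2l ?expR_gt0.
by rewrite -expRD ler_expR; lra.
Qed.

End all_tilts.

(** * Upper and lower large deviation bounds in one environment *)

Section limits.
Variable R : realType.
Implicit Types u : nat -> \bar R.
Local Open Scope ereal_scope.

Lemma limn_esup_le_near u l : (\forall n \near \oo, u n <= l) -> limn_esup u <= l.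
Proof.
move=> [N _ Nu]; rewrite /limn_esup limf_esupE.
apply: ereal_inf_le; exists (ereal_sup (u @` [set n | (N <= n)%N])).
  by exists [set n | (N <= n)%N] => //; exists N.
by apply: ge_ereal_sup => _ [n Nn <-]; exact: Nu.
Qed.

Lemma limn_einf_ge_near u l : (\forall n \near \oo, l <= u n) -> l <= limn_einf u.
Proof.
move=> lu; rewrite /limn_einf leeNr; apply: limn_esup_le_near.
by apply: filterS lu => n; rewrite leeN2.
Qed.

Lemma lne_scaled_le (n : nat) (p : \bar R) (a : R) : (0 < n)%N -> 0 <= p ->
  p <= (expR (a * n%:R))%:E -> (n%:R^-1)%:E * lne p <= a%:E.
Proof.
move=> n0 p0 pa.
have n0' : (0 < n%:R :> R)%R by rewrite ltr0n.
rewrite lee_pdivrMl//.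
have : lne p <= lne (expR (a * n%:R))%:E.
  by rewrite lee_lne// in_itv/= ?leey ?andbT// lee_fin expR_ge0.
move=> /le_trans; apply.
by rewrite lne_EFin ?expR_gt0// expRK -EFinM mulrC.
Qed.

Lemma lne_scaled_ge (n : nat) (p : \bar R) (a : R) : (0 < n)%N ->
  (expR (a * n%:R))%:E <= p -> a%:E <= (n%:R^-1)%:E * lne p.
Proof.
move=> n0 pa; have n0' : (0 < n%:R :> R)%R by rewrite ltr0n.
have p0 : 0 <= p by apply: le_trans pa; rewrite lee_fin expR_ge0.
rewrite lee_pdivlMl//.
have : lne (expR (a * n%:R))%:E <= lne p.
  by rewrite lee_lne// in_itv/= ?leey ?andbT// lee_fin expR_ge0.
by apply: le_trans; rewrite lne_EFin ?expR_gt0// expRK -EFinM mulrC.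
Qed.

End limits.

Lemma ereal_between (R : realType) (x y : \bar R) : (x < y)%E ->
  exists2 a : R, (x < a%:E)%E & (a%:E < y)%E.
Proof.
case: x => [x| |]; case: y => [y| |] //=.
- by rewrite lte_fin => xy; exists ((x + y) / 2); rewrite lte_fin; lra.
- by move=> _; exists (x + 1); rewrite ?ltry// lte_fin ltrDl.
- by move=> _; exists (y - 1); rewrite ?ltNyr// lte_fin gtrBl.
- by move=> _; exists 0; rewrite ?ltNyr ?ltry.
Qed.

Section large_deviations.
Variables (R : realType) (d : nat) (P : probability (env R d) R).
Hypothesis iid : iid_env P.
Variable c : R.
Hypothesis c_gt0 : 0 < c.
Hypothesis c_good : {ae P, forall w, good c w}.
Variables (w : env R d) (Q : probability (walk d) R) (r : R).
Hypothesis w_good : good c w.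
Hypothesis w_growth : growth P r w.
Hypothesis lawQ : quenched_law w Q.
Implicit Types (th xi v : 'rV[R]_d) (B : set 'rV[R]_d).

(** The quenched expectation of [g (X_n)]; probabilities of velocities and exponential moments are
    both instances of it. *)
Let M n g : R := iterK (fun t y s => w t%:Z y (st s)) g n 0 0.
Let at_speed n B : set (site d) := [set y | B (n%:R^-1 *: embed R y)].
Let mgf0 th : 0 < mgf P th := mgf_gt0 iid c_gt0 c_good th.
Local Notation J := (recentred_mgf (q P)).

Let le_M n g g' : (forall y, 0 <= g y <= g' y) -> M n g <= M n g'.
Proof.
move=> gg'; rewrite -[leRHS]mul1r -(expr1n _ n); apply: le_iterK => // t x s.
by rewrite mul1r lexx prob_vector_ge0.
Qed.

Let M_exp n th :
  M n (fun y => expR (dot th (embed R y))) = mgf P th ^+ n * partfun (tilt P th) w n 0 0.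
Proof.
rewrite /M (eq_iterK (g' := fun y => expR (dot th (embed R y)) * 1) _ _ _ (fun _ _ _ => erefl));
  last by move=> y; rewrite mulr1.
rewrite (@iterK_tilt _ _ _ _ (mgf P th)) ?gt_eqF// embed0 dot0r expR0 mulr1; congr (_ * _).
by apply: eq_iterK => // t x s; rewrite /env_kernel /tilt mulrA.
Qed.

Let Q_velocity n B : Q [set X | B (velocity R n X)] = (M n \1_(at_speed n B))%:E.
Proof.
rewrite -(quenched_lawE (Q := Q)) => [|m x|//].
  by [].
by apply: prob_vector_sum_st => z; exact: (w_good _ _).1.
Qed.

Let M_ge0 n B : 0 <= M n \1_(at_speed n B).
Proof. by apply: iterK_ge0 => [*|x]; [exact: prob_vector_ge0|rewrite indicE]. Qed.

Let exp_scale n th xi y : (0 < n)%N -> n%:R^-1 *: embed R y = xi ->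
  dot th (embed R y) = n%:R * dot th xi.
Proof.
move=> n0 <-; rewrite dotZr mulrA divff ?mul1r// pnatr_eq0; lia.
Qed.

Definition tilted_rate th xi : R := dot th xi - ln (mgf P th).

Let mgf_expn n th : mgf P th ^+ n = expR (n%:R * ln (mgf P th)).
Proof. by rewrite mulrC expRM_natr lnK// posrE. Qed.

Let exp_tilted_rate n th xi : expR (n%:R * tilted_rate th xi) =
  expR (n%:R * dot th xi) / mgf P th ^+ n.
Proof.
by rewrite mgf_expn -expRN -expRD; congr expR; rewrite /tilted_rate; ring.
Qed.

Lemma tilted_rate_le th xi : ((tilted_rate th xi)%:E <= averaged_rate P xi)%E.
Proof. by apply: ereal_sup_ubound; exists th. Qed.

Let JE xi th : J xi th = expR (- tilted_rate th xi).
Proof.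
rewrite /recentred_mgf /tilted_rate opprB expRD lnK ?posrE// mgfE mulr_suml.
by apply: eq_bigr => s _; rewrite dotBr expRD mulrA.
Qed.

Lemma averaged_rate_saddle th xi : (forall th', J xi th <= J xi th') ->
  averaged_rate P xi = (tilted_rate th xi)%:E.
Proof.
move=> h; apply/eqP; rewrite eq_le tilted_rate_le andbT.
apply: ge_ereal_sup => _ [th' _ <-]; rewrite lee_fin.
by have := h th'; rewrite !JE ler_expR lerN2.
Qed.

(* Exponential Chebyshev inequality over a finite union of half-spaces. *)
Lemma quenched_half_spaces n (a : R) (s : seq 'rV[R]_d) B : (0 < n)%N ->
  (forall xi, B xi -> exists2 th, th \in s & a <= tilted_rate th xi) ->
  M n \1_(at_speed n B) <= \sum_(th <- s) expR (- (n%:R * a)) * partfun (tilt P th) w n 0 0.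
Proof.
move=> n0 Bs.
have -> : \sum_(th <- s) expR (- (n%:R * a)) * partfun (tilt P th) w n 0 0 =
    M n (fun y => \sum_(th <- s) expR (- (n%:R * a)) / mgf P th ^+ n * expR (dot th (embed R y))).
  elim: s {Bs} => [|th s ih].
    rewrite big_nil /M -[LHS](mul0r (iterK (fun t y s => w t%:Z y (st s)) (fun=> 1) n 0 0)) -iterKZ.
    by apply: eq_iterK => // y; rewrite big_nil mul0r.
  rewrite big_cons ih /M.
  rewrite -[in RHS](eq_iterK _ _ _ (fun _ _ _ => erefl) (fun y => esym (big_cons _ _ _ _ _ _))).
  rewrite iterKD; congr (_ + _); rewrite iterKZ -/(M n _) M_exp mulrA.
  by rewrite divfK// expf_neq0// gt_eqF.
apply: le_M => y; rewrite indicE ler0n/=.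
have pos th : 0 <= expR (- (n%:R * a)) / mgf P th ^+ n * expR (dot th (embed R y)).
  by rewrite mulr_ge0 ?expR_ge0// divr_ge0 ?expR_ge0// exprn_ge0// ltW.
case: (boolP (y \in _)) => /= [|_]; last by apply: sumr_ge0.
rewrite inE => /Bs[th ths h].
rewrite (big_rem th)//= -[leLHS]addr0 lerD//; last by apply: sumr_ge0.
set x := n%:R^-1 *: embed R y in h.
rewrite (exp_scale th n0 (erefl x)) -mulrA [X in _ * X]mulrC.
rewrite -(exp_tilted_rate n th x) -expRD.
rewrite -[leLHS]expR0 ler_expR addrC subr_ge0 ler_pM2l// ltr0n//.
Qed.

Lemma sum_pf_le (s : seq 'rV[R]_d) (e : R) : 0 < e -> (forall th, th \in s -> `|th| < r) ->
  \forall n \near \oo,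
    \sum_(th <- s) partfun (tilt P th) w n 0 0 <= (size s)%:R * expR (e * n%:R).
Proof.
move=> e0; elim: s => [|th s ih] sr.
  by near=> n; rewrite big_nil mul0r.
have h1 := w_growth (sr th (mem_head _ _)) e0.
have h2 := ih (fun th' h => sr th' (mem_behead (s := th :: s) h)).
apply: filterS2 h1 h2 => n /andP[_ n1] n2.
by rewrite big_cons/= -natr1 mulrDl mul1r addrC lerD.
Unshelve. all: by end_near. Qed.

Lemma const_le_exp (k e : R) : 0 < e -> \forall n \near \oo, k <= expR (e * n%:R).
Proof.
move=> e0; have [N NE] := nat_above (k / e); exists N => // n /= Nn.
apply: (le_trans _ (expR_ge1Dx _)).
have : k <= e * n%:R.
  by rewrite mulrC -ler_pdivrMr// (le_trans NE)// ler_nat.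
lra.
Qed.

Variable O : set 'rV[R]_d.
Hypothesis O_bounded : bounded_set O.
Hypothesis O_saddle : forall xi, O xi -> exists th, [/\ `|th| < r,
  forall th', J xi th <= J xi th' &
  forall v delta, 0 < delta -> exists t,
    [/\ 0 < t, `|th + t *: v| < r & J xi (th + t *: v) < J xi th * expR (t * delta)]].

Let log_prob B n : \bar R := ((n%:R^-1)%:E * lne (Q [set X | B (velocity R n X)]))%E.

(** [F] is compact, as [O] is bounded, and the saddle of each of its points gives an open half-space
    with [|th| < r] on which [tilted_rate th] is large. A finite subcover reduces the claim to
    [quenched_half_spaces]. *)
Lemma quenched_upper_bound F : closed F -> F `<=` O ->
  (limn_esup (log_prob F) <= - ereal_inf (averaged_rate P @` F))%E.
Proof.
move=> cF FO; rewrite leNgt; apply/negP => lt.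
have [a [b [ab a1 b1]]] : exists a b : R, [/\ a < b,
    ((- a)%:E < limn_esup (log_prob F))%E &
    (b%:E <= ereal_inf (averaged_rate P @` F))%E].
  move: lt; rewrite lteNl => /ereal_between[a a1 /ereal_between[b]].
  rewrite lte_fin => ab b1; exists a, b; split => //; last exact: ltW.
  by rewrite EFinN lteNl.
have compF : compact F.
  apply: bounded_closed_compact => //.
  by have [m [mr h]] := O_bounded; exists m; split => // x mx y /FO; exact: h.
pose U th : set 'rV[R]_d := [set xi | (a + b) / 2 < tilted_rate th xi].
have oU th : open (U th).
  rewrite (_ : U th = (fun xi => dot xi th) @^-1` [set x | (a + b) / 2 + ln (mgf P th) < x]).
    by apply: open_comp; [move=> xi _; exact: continuous_dot|exact: open_gt].
  by apply/seteqP; split => xi; rewrite /U/= /tilted_rate dotC ltrBrDr.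
have Fcov : F `<=` cover [set th : 'rV[R]_d | `|th| < r] U.
  move=> xi Fxi; have [th [thr h _]] := O_saddle (FO _ Fxi).
  exists th => //; rewrite /U/= -lte_fin -(averaged_rate_saddle h).
  apply: lt_le_trans (le_trans b1 _); first by rewrite lte_fin; lra.
  by apply: ereal_inf_lbound; exists xi.
rewrite compact_cover in compF.
have [D Dr FD] := compF _ _ _ (fun th _ => oU th) Fcov.
have near_le : \forall n \near \oo, (log_prob F n <= (- a)%:E)%E.
  (* The midpoint is above [a] by [(b - a) / 2]; one [e] pays for the partition functions and one
     for the number of tilts. *)
  set e := (b - a) / 8.
  have e0 : 0 < e by rewrite divr_gt0// subr_gt0.
  have h1 : \forall n \near \oo,
      \sum_(th <- finmap.enum_fset D) partfun (tilt P th) w n 0 0 <=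
      (size (finmap.enum_fset D))%:R * expR (e * n%:R).
    by apply: sum_pf_le => // th thD; have := Dr th thD; rewrite inE.
  have h2 := const_le_exp (size (finmap.enum_fset D))%:R e0.
  have h3 : \forall n \near \oo, (0 < n)%N by exists 1%N.
  apply: filterS3 h1 h2 h3 => n n1 n2 n0.
  apply: lne_scaled_le => //.
  rewrite Q_velocity lee_fin.
  have := @quenched_half_spaces n ((a + b) / 2) (finmap.enum_fset D) F n0.
  have Fs xi : F xi -> exists2 th, th \in finmap.enum_fset D & (a + b) / 2 <= tilted_rate th xi.
    by move=> /FD[th thD /ltW]; exists th.
  move=> /(_ Fs)/le_trans; apply; rewrite -mulr_sumr.
  apply: (@le_trans _ _ (expR (- (n%:R * ((a + b) / 2))) * (expR (e * n%:R) * expR (e * n%:R)))).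
    rewrite ler_pM2l ?expR_gt0// (le_trans n1)// ler_pM2r ?expR_gt0//.
  rewrite -!expRD ler_expR /e.
  have : 0 <= (b - a) * n%:R by rewrite mulr_ge0// subr_ge0 ltW.
  lra.
by have := limn_esup_le_near near_le; rewrite leNgt a1.
Qed.

(** If [x] is at sup distance at least [dl] from [xi], some unit step [v] has [<v, x - xi> >= dl],
    and there the exponential of [th] lies below a multiple of that of [th + t * v]. These [2d]
    tilts have exponentially smaller total mass, so the mass of the tilt by [th] must come from the
    ball around [xi]. *)
Lemma quenched_lower_bound G : open G -> G `<=` O ->
  (- ereal_inf (averaged_rate P @` G) <= limn_einf (log_prob G))%E.
Proof.
move=> oG GO; rewrite leeNl; apply: le_ereal_inf_tmp => _ [xi Gxi <-].
rewrite leeNl.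
have [th [thr min_th steep]] := O_saddle (GO _ Gxi).
rewrite (averaged_rate_saddle min_th).
set b := tilted_rate th xi.
apply/lee_addgt0Pr => e e0.
rewrite -leeBlDr// -EFinN -EFinB; apply: limn_einf_ge_near.
have [dl0 dl00 ballG] : exists2 dl0 : R, 0 < dl0 & forall x, `|x - xi| < dl0 -> G x.
  have /nbhs_normP[dl0 /= dl00 h] : nbhs xi G by exact: open_nbhs_nbhs.
  by exists dl0 => // x xd; apply: h; rewrite /ball_/= distrC.
(* The first condition puts the ball in [G]; the second bounds [<th, x - xi>] by [e / 4] on it. *)
have [dl dl_gt0 dlP] := @small_scalar R _ (fun i : bool => if i then 1 else d%:R * `|th|)
  (fun i : bool => if i then dl0 else e / 4) (ltac:(by case; rewrite ?mulr_ge0))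
  (ltac:(by case => //; rewrite divr_gt0)).
have dl_small : dl < dl0 by have := dlP true; rewrite mulr1.
have dl_th : dl * (d%:R * `|th|) < e / 4 := dlP false.
pose v (s : step d) : 'rV[R]_d := embed R (st s).
have [t tP] := choice (fun s => steep (v s) dl dl_gt0).
pose ths s := th + t s *: v s.
have t0 s : 0 < t s by have [] := tP s.
have thsr s : `|ths s| < r by have [] := tP s.
(* The exponential rate by which the tilt [ths s] loses against [th]; its positivity is the estimate
   of the saddle read through logarithms. *)
pose ka s := tilted_rate (ths s) xi - b + t s * dl.
have ka0 s : 0 < ka s.
  by have [_ _] := tP s; rewrite !JE -expRD ltr_expR /ka /ths /b; lra.
have [k k0 kP] := @small_scalar R _ (fun=> 1) ka (fun=> ler01) ka0.
have {}kP s : k <= ka s by have := kP s; rewrite mulr1 => /ltW.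
set e' := Num.min (k / 4) (e / 4).
have e'0 : 0 < e' by rewrite lt_min !divr_gt0.
have e'1 : e' <= k / 4 by rewrite ge_min lexx.
have e'2 : e' <= e / 4 by rewrite ge_min lexx orbT.
pose S : R := (size (index_enum (step d)))%:R.
have ev1 := w_growth thr e'0.
have ev2 : \forall n \near \oo,
    \sum_s partfun (tilt P (ths s)) w n 0 0 <= S * expR (e' * n%:R).
  have : forall th', th' \in [seq ths s | s <- index_enum (step d)] -> `|th'| < r.
    by move=> _ /mapP[s _ ->].
  move=> /(sum_pf_le e'0); apply: filterS => n.
  by rewrite big_map size_map.
have ev3 := const_le_exp (2 * S) (divr_gt0 k0 (ltr0n R 2)).
have ev4 := const_le_exp 2 (divr_gt0 e0 (ltr0n R 4)).
have ev5 : \forall n \near \oo, (0 < n)%N by exists 1%N.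
near=> n.
have n0 : (0 < n)%N by near: n.
have n0' : 0 < n%:R :> R by rewrite ltr0n.
have n1 : expR (- (e' * n%:R)) <= partfun (tilt P th) w n 0 0.
  by have /andP[] : expR (- (e' * n%:R)) <= partfun (tilt P th) w n 0 0 <= expR (e' * n%:R)
    by near: n.
have n2 : \sum_s partfun (tilt P (ths s)) w n 0 0 <= S * expR (e' * n%:R) by near: n.
have n3 : 2 * S <= expR (k / 2 * n%:R) by near: n.
have n4 : 2 <= expR (e / 4 * n%:R) by near: n.
rewrite /log_prob; apply: lne_scaled_ge => //.
rewrite Q_velocity lee_fin.
pose A := expR (- (n%:R * (dot th xi + e / 4))).
pose B s := expR (- (n%:R * (dot (ths s) xi + e / 4 + t s * dl))).
(* [A] brings the left side below 1 on the ball, and [B s] makes the [s] term dominate it where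
   [<v s, x - xi> >= dl]. *)
have pointwise y : A * expR (dot th (embed R y)) <=
    \1_(at_speed n G) y + \sum_s B s * expR (dot (ths s) (embed R y)).
  set x := n%:R^-1 *: embed R y.
  have Bpos s : 0 <= B s * expR (dot (ths s) (embed R y)) by rewrite mulr_ge0 ?expR_ge0.
  have Bsum : 0 <= \sum_s B s * expR (dot (ths s) (embed R y)) by apply: sumr_ge0.
  have [near_xi|far_xi] := ltP `|x - xi| dl.
    have yG : y \in at_speed n G by rewrite inE; apply: ballG; exact: lt_trans dl_small.
    rewrite indicE yG -[leLHS]addr0 lerD// /A -expRD -[leRHS]expR0 ler_expR.
    rewrite (exp_scale th n0 (erefl x)).
    have : dot th (x - xi) <= e / 4.
      rewrite (le_trans (ler_norm _))// (le_trans (norm_dot_le _ _))//.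
      apply: le_trans (ltW dl_th); rewrite mulrA mulrC ler_wpM2r ?mulr_ge0//.
      exact: ltW.
    rewrite dotBr => h; rewrite addrC -mulrBr pmulr_rle0//; lra.
  have [i xi_i] : exists i, `|x - xi| = `|(x - xi) 0 i|.
    have /mx_norm_neq0[[k' i] E] : mx_norm (x - xi) != 0.
      by rewrite -[mx_norm _]/(`|x - xi|) gt_eqF// (lt_le_trans dl_gt0).
    by exists i; rewrite -[`|x - xi|]/(mx_norm (x - xi)) E ord1.
  pose s : step d := (i, (x - xi) 0 i < 0).
  have vs : dl <= dot (v s) (x - xi).
    rewrite dotC dot_st/= (le_trans far_xi)// xi_i.
    by case: ltrP => h; [rewrite expr1 mulN1r ltr0_norm|rewrite expr0 mul1r ger0_norm].
  rewrite (bigD1 s)//= -[leLHS]add0r lerD ?indicE ?ler0n//.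
  rewrite -[leLHS]addr0 lerD//; last by apply: sumr_ge0.
  rewrite /A /B -!expRD ler_expR !(exp_scale _ n0 (erefl x)) /ths !dotDl !dotZl.
  have : 0 <= n%:R * (t s * (dot (v s) (x - xi) - dl)).
    by rewrite mulr_ge0// mulr_ge0 ?subr_ge0// ltW.
  by rewrite dotBr; lra.
have AE : A * mgf P th ^+ n = expR (- (n%:R * (b + e / 4))).
  by rewrite mgf_expn /A -expRD; congr expR; rewrite /b /tilted_rate; ring.
have BE s : B s * mgf P (ths s) ^+ n = expR (- (n%:R * (b + e / 4))) * expR (- (n%:R * ka s)).
  rewrite mgf_expn /B -!expRD; congr expR.
  by rewrite /ka /b /tilted_rate; ring.
have key : A * mgf P th ^+ n * partfun (tilt P th) w n 0 0 <= M n \1_(at_speed n G) +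
    \sum_s B s * mgf P (ths s) ^+ n * partfun (tilt P (ths s)) w n 0 0.
  have -> : A * mgf P th ^+ n * partfun (tilt P th) w n 0 0 =
      M n (fun y => A * expR (dot th (embed R y))).
    by rewrite /M iterKZ -/(M n _) M_exp mulrA.
  have -> : \sum_s B s * mgf P (ths s) ^+ n * partfun (tilt P (ths s)) w n 0 0 =
      M n (fun y => \sum_s B s * expR (dot (ths s) (embed R y))).
    by rewrite /M iterK_sum; apply: eq_bigr => s _; rewrite iterKZ -/(M n _) M_exp mulrA.
  rewrite /M -iterKD -!/(M n _); apply: le_M => y.
  by rewrite mulr_ge0 ?expR_ge0//= pointwise.
set X := expR (- (n%:R * (b + e / 4))) in AE BE.
have X0 : 0 < X by exact: expR_gt0.
have pf0 s : 0 <= partfun (tilt P (ths s)) w n 0 0.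
  by apply: (nnm_pf _ n 0 0).2 => s'; rewrite ltW// (tilt_gt0 iid c_gt0 c_good).
have tail : \sum_s B s * mgf P (ths s) ^+ n * partfun (tilt P (ths s)) w n 0 0 <=
    X * (expR (- (n%:R * k)) * (S * expR (e' * n%:R))).
  rewrite mulrA; apply: (@le_trans _ _ (X * expR (- (n%:R * k)) * \sum_s partfun (tilt P (ths s)) w n 0 0)).
    rewrite mulr_sumr; apply: ler_sum => s _; rewrite BE ler_wpM2r// ler_pM2l//.
    by rewrite ler_expR lerN2 ler_pM2l.
  by rewrite ler_wpM2l// mulr_ge0 ?expR_ge0// ltW.
rewrite AE in key.
(* Of the gap [k], one half absorbs [2 * S] and the other the fluctuations, as [2 * e' <= k / 2]. *)
have half : expR (- (n%:R * k)) * (S * expR (e' * n%:R)) <= 2^-1 * expR (- (e' * n%:R)).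
  have : S <= 2^-1 * expR (k / 2 * n%:R) by lra.
  rewrite -(ler_pM2r (expR_gt0 (e' * n%:R - n%:R * k))) -[leRHS]mulrA -expRD => h.
  rewrite mulrCA -expRD [X in expR X]addrC; apply: le_trans h _.
  rewrite ler_pM2l ?invr_gt0// ler_expR.
  have : 0 <= (k / 4 - e') * n%:R by rewrite mulr_ge0// subr_ge0.
  lra.
have Q_ge : X * (2^-1 * expR (- (e' * n%:R))) <= M n \1_(at_speed n G).
  have := le_trans key (lerD (lexx _) tail); rewrite -lerBlDr; apply: le_trans.
  rewrite -mulrBr ler_pM2l//; lra.
apply: le_trans Q_ge.
have {}n4 : expR (- (e / 4 * n%:R)) <= 2^-1 by rewrite expRN lef_pV2 ?posrE ?expR_gt0.
apply: (@le_trans _ _ (X * (expR (- (e / 4 * n%:R)) * expR (- (e' * n%:R))))).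
  rewrite /X -!expRD ler_expR.
  have : 0 <= (e / 4 - e') * n%:R by rewrite mulr_ge0// subr_ge0.
  have : 0 <= e * n%:R by rewrite mulr_ge0// ltW.
  lra.
by rewrite ler_pM2l// ler_pM2r ?expR_gt0.
Unshelve. all: by end_near. Qed.

End large_deviations.

(** * Regularity of the averaged rate, and the conclusion *)

Section averaged_rate.
Variables (R : realType) (d : nat) (P : probability (env R d) R).
Hypothesis iid : iid_env P.
Variable c : R.
Hypothesis c_gt0 : 0 < c.
Hypothesis c_good : {ae P, forall w, good c w}.

Lemma lln_velocityE : lln_velocity P = drift_velocity (q P).
Proof. exact: sum_unit_steps. Qed.

Lemma open_tilted_rate_gt th a : open [set xi | a < tilted_rate P th xi].
Proof.
have -> : [set xi | a < tilted_rate P th xi] =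
    (fun xi => dot xi th) @^-1` [set x | a + ln (mgf P th) < x].
  by apply/seteqP; split => xi; rewrite /= /tilted_rate dotC ltrBrDr.
by apply: open_comp; [move=> x _; exact: continuous_dot|exact: open_gt].
Qed.

Lemma averaged_rate_ge0 xi : (0 <= averaged_rate P xi)%E.
Proof.
apply: le_trans (tilted_rate_le P 0 xi); rewrite lee_fin /tilted_rate mgfE.
under eq_bigr do rewrite dot0l expR0 mulr1.
by rewrite (sum_q iid c_good) ln1 dot0l subrr.
Qed.

(** A supremum of affine functions: the one that exceeds [a] at [xi] does so on a neighbourhood. *)
Lemma averaged_rate_lsc (O : set 'rV[R]_d) :
  lower_semicontinuous (averaged_rate P : subspace O -> \bar R).
Proof.
move=> xi a /ereal_sup_gt[_ [th _ <-]]; rewrite lte_fin => ath.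
exists [set xi' | a < tilted_rate P th xi'] => [|xi' h].
  have xiN : nbhs (xi : 'rV[R]_d) [set xi' | a < tilted_rate P th xi'].
    apply: open_nbhs_nbhs; split => //.
    exact: open_tilted_rate_gt.
  rewrite -[nbhs _ _]/(nbhs_subspace xi _).
  rewrite /nbhs_subspace; case: ifPn => _; last by move=> _ ->.
  by apply: filterS xiN => xi' + _.
by apply: lt_le_trans (tilted_rate_le P th xi'); rewrite lte_fin.
Qed.

End averaged_rate.

Lemma enorm_ball_open (R : realType) d (v : 'rV[R]_d) (eta : R) :
  open [set xi | enorm (xi - v) < eta].
Proof.
have : open ((fun xi => enorm (xi - v)) @^-1` [set x : R | x < eta]).
  apply: open_comp; last exact: open_lt.
  move=> x _; apply: continuous_comp; last exact: continuous_enorm.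
  by move=> U; exact: (cvgB cvg_id (cvg_cst v)).
by [].
Qed.

Lemma enorm_ball_bounded (R : realType) d (v : 'rV[R]_d) (eta : R) :
  bounded_set [set xi | enorm (xi - v) < eta].
Proof.
exists (eta + `|v|); split; first exact: num_real.
move=> x hx xi h; rewrite /= -(subrK v xi) (le_trans (ler_normD _ _))//.
apply: le_trans (ltW hx); rewrite lerD2r.
exact: le_trans (norm_le_enorm _) (ltW h).
Qed.

Lemma growth_mono (R : realType) d (P : probability (env R d) R) r r' w : r' <= r ->
  growth P r w -> growth P r' w.
Proof. by move=> rr g th e thr; apply: g; exact: lt_le_trans rr. Qed.

Theorem theorem2 (R : realType) (d : nat) (P : probability (env R d) R)
    (Pq : env R d -> probability (walk d) R) :
  (3 <= d)%N ->
  iid_env P -> nearest_neighbor P -> uniformly_elliptic P ->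
  (forall w, quenched_law w (Pq w)) ->
  exists2 eta : R, 0 < eta &
    quenched_LDP P Pq [set xi | enorm (xi - lln_velocity P) < eta]
      (averaged_rate P).
Proof.
move=> d3 iid nn ell lawQ.
have [c c0 c_good] := good_ae iid nn ell.
have [r r0 gr] := growth_ae iid c0 c_good d3.
(* The cap [1/2] is the range of the quadratic lower bound in [saddle]; [growth] survives a smaller
   radius by [growth_mono]. *)
have r'0 : 0 < Num.min r 2^-1 by rewrite lt_min r0 invr_gt0 ltr0n.
have d0 : (0 < d)%N by exact: leq_trans d3.
have r'h : Num.min r 2^-1 <= 2^-1 by rewrite ge_min lexx orbT.
have [eta eta0 sad] := saddle c0 (q_ge iid c0 c_good) (sum_q iid c_good) r'0 r'h d0.
exists eta => //; rewrite lln_velocityE; split.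
- exact: enorm_ball_open.
- by move=> xi _; exact: (averaged_rate_ge0 iid c_good).
- exact: averaged_rate_lsc.
- apply: filterS2 (c_good) gr => w gw grw.
  have {}grw : growth P (Num.min r 2^-1) w by apply: growth_mono grw; rewrite ge_min lexx.
  split=> B h1 h2.
    exact: (quenched_lower_bound iid c0 c_good gw grw (lawQ w) sad h1 h2).
  exact: (quenched_upper_bound iid c0 c_good gw grw (lawQ w) (@enorm_ball_bounded _ _ _ _) sad h1 h2).
Qed.
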